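(* Let $q\ge 2$ and $n$ be integers such that the class $\mathcal{B}(n,q)$ is nonempty, and put $b=\frac{n-1}{q}$. (1) For every $G\in\mathcal{B}(n,q)$ we have $\rho(G)\le\rho(S(n,q))$, and $S(n,q)$ is, up to isomorphism, the unique graph in $\mathcal{B}(n,q)$ that maximizes the spectral radius. (2) For every $G\in\mathcal{B}(n,q)$ having at most three pairwise adjacent cut vertices (that is, $G$ has no four pairwise adjacent cut vertices) we have $\rho(P_b^q)\le\rho(G)$, and $P_b^q$ is, up to isomorphism, the unique graph minimizing the spectral radius among the graphs in $\mathcal{B}(n,q)$ with at most three pairwise adjacent cut vertices.
   Context: All graphs are finite and simple. $\rho(G)$ denotes the spectral radius of the adjacency matrix of $G$. A cut vertex is a vertex whose removal increases the number of connected components. A block of a graph is a maximal connected subgraph having no cut vertex (of its own). A block graph is a connected graph all of whose blocks are complete graphs. For $q\ge 2$, $\mathcal{B}(n,q)$ is the class of block graphs on $n$ vertices all of whose blocks have exactly $q+1$ vertices; such a graph has exactly $b=\frac{n-1}{q}\ge 1$ blocks. $S(n,q)$ is the graph in $\mathcal{B}(n,q)$ whose $b$ blocks all share one common vertex (which is the only cut vertex if $b\ge2$; $S(q+1,q)=K_{q+1}$). A leaf block is a block containing exactly one cut vertex of the graph. $P_b^q$, the $(q,b)$-path-block, is the graph in $\mathcal{B}(bq+1,q)$ with at most two leaf blocks; equivalently, its blocks can be ordered $B_1,\dots,B_b$ so that $V(B_i)\cap V(B_{i+1})=\{v_i\}$ for $1\le i\le b-1$ and $V(B_i)\cap V(B_j)=\emptyset$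 whenever $|i-j|>1$ (so $P_1^q=K_{q+1}$). *)

(* Defs.v *)
From HB Require Import structures.
From mathcomp Require Import all_boot all_order all_algebra.

Set Implicit Arguments.
Unset Strict Implicit.
Unset Printing Implicit Defensive.

Import Order.TTheory GRing.Theory Num.Theory.

(* Finite simple graphs *)

Record sgraph : Type := SGraph {
  vertex :> finType;
  adj : rel vertex;
  adj_sym : symmetric adj;
  adj_irrefl : irreflexive adj }.

Arguments adj {s} x y : rename.

Definition iso (G H : sgraph) : Prop :=
  exists f : G -> H, bijective f /\ forall x y, adj (f x) (f y) = adj x y.

Definition complete (G : sgraph) : Prop := forall x y : G, x != y -> adj x y.

Definition components (G : sgraph) : nat := n_comp (@adj G) predT.

(* The graph without vertices has no component, so it is not connected. *)
Definition connected (G : sgraph) : Prop := components G = 1.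

Section VertexDeletion.
Variables (G : sgraph) (v : G).

Definition del_adj : rel {x : G | x != v} := fun x y => adj (val x) (val y).

Fact del_adj_sym : symmetric del_adj.
Proof. by move=> x y; apply: adj_sym. Qed.

Fact del_adj_irrefl : irreflexive del_adj.
Proof. by move=> x; apply: adj_irrefl. Qed.

Definition del_vertex : sgraph := SGraph del_adj_sym del_adj_irrefl.
End VertexDeletion.

Definition cut_vertex (G : sgraph) (v : G) : bool :=
  components G < components (del_vertex v).

(* Subgraphs (not necessarily induced) *)

Record subgraph (G : sgraph) : Type := Subgraph {
  sub_vertices : {set G};
  sub_edges : rel G;
  sub_edges_sym : symmetric sub_edges;
  sub_edgesP : forall x y, sub_edges x y ->
    [/\ x \in sub_vertices, y \in sub_vertices & adj x y] }.

Section SubgraphAsGraph.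
Variables (G : sgraph) (H : subgraph G).

Definition sub_adj : rel {x : G | x \in sub_vertices H} :=
  fun x y => sub_edges H (val x) (val y).

Fact sub_adj_sym : symmetric sub_adj.
Proof. by move=> x y; apply: sub_edges_sym. Qed.

Fact sub_adj_irrefl : irreflexive sub_adj.
Proof.
move=> x; apply/negP => /(sub_edgesP (s := H)) [_ _].
by rewrite adj_irrefl.
Qed.

Definition graph_of_subgraph : sgraph := SGraph sub_adj_sym sub_adj_irrefl.
End SubgraphAsGraph.

Coercion graph_of_subgraph : subgraph >-> sgraph.

Definition subgraph_le (G : sgraph) (H K : subgraph G) : Prop :=
  sub_vertices H \subset sub_vertices K /\ subrel (sub_edges H) (sub_edges K).

Definition nonseparable (G : sgraph) : Prop :=
  connected G /\ forall v : G, ~~ cut_vertex v.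

Definition is_block (G : sgraph) (H : subgraph G) : Prop :=
  nonseparable H /\
  forall K : subgraph G, nonseparable K -> subgraph_le H K -> subgraph_le K H.

Definition block_graph (G : sgraph) : Prop :=
  connected G /\ forall H : subgraph G, is_block H -> complete H.

(* The class B(n, q) *)
Definition block_class (n q : nat) (G : sgraph) : Prop :=
  [/\ block_graph G, #|G| = n &
      forall H : subgraph G, is_block H -> #|H| = q.+1].

Definition at_most_3_adjacent_cut_vertices (G : sgraph) : Prop :=
  forall K : {set G},
    {in K, forall x, cut_vertex x} ->
    {in K &, forall x y, x != y -> adj x y} ->
    #|K| <= 3.

(* The star S(bq+1, q): [None] is the common vertex, and the k-th block       *)
(* consists of [None] and of the q vertices [Some (k, i)].                    *)
Section StarBlock.
Variables q b : nat.

Definition star_adj : rel (option ('I_b * 'I_q)) := fun x y =>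
  (x != y) && (match x, y with
               | Some (k, _), Some (l, _) => k == l
               | _, _ => true
               end).

Fact star_adj_sym : symmetric star_adj.
Proof.
move=> x y; rewrite /star_adj eq_sym.
by case: x y => [[k i]|] [[l j]|] //; rewrite [k == l]eq_sym.
Qed.

Fact star_adj_irrefl : irreflexive star_adj.
Proof. by move=> x; rewrite /star_adj eqxx. Qed.

Definition star_block : sgraph := SGraph star_adj_sym star_adj_irrefl.
End StarBlock.

(* The path-block P_b^q: the vertices are 0, ..., bq, and the k-th block      *)
(* (k < b) is the interval {kq, ..., (k+1)q}; consecutive blocks share the    *)
(* vertex (k+1)q.                                                             *)
Section PathBlock.
Variables q b : nat.

Definition path_adj : rel 'I_(b * q).+1 := fun x y =>
  (x != y) &&
  [exists k : 'I_b, (k * q <= x <= k.+1 * q) && (k * q <= y <= k.+1 * q)].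

Fact path_adj_sym : symmetric path_adj.
Proof.
move=> x y; rewrite /path_adj eq_sym; congr (_ && _).
by apply: eq_existsb => k; rewrite andbC.
Qed.

Fact path_adj_irrefl : irreflexive path_adj.
Proof. by move=> x; rewrite /path_adj eqxx. Qed.

Definition path_block : sgraph := SGraph path_adj_sym path_adj_irrefl.
End PathBlock.

Local Open Scope ring_scope.

Definition adj_matrix (C : numClosedFieldType) (G : sgraph) : 'M[C]_#|G| :=
  \matrix_(i, j) (adj (enum_val i) (enum_val j))%:R.

Definition eigenvalues (C : numClosedFieldType) (m : nat) (A : 'M[C]_m) :
  seq C := sval (closed_field_poly_normal (char_poly A)).

(* C stands for the complex numbers; its order is partial, but moduli are    *)
(* real, hence pairwise comparable.                                           *)
Definition spectral_radius (C : numClosedFieldType) (m : nat) (A : 'M[C]_m) :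
  C := \big[Num.max/0]_(z <- eigenvalues A) `|z|.

Definition rho (C : numClosedFieldType) (G : sgraph) : C :=
  spectral_radius (adj_matrix C G).

(* Main.v *)
(* Both parts compare Perron vectors.

   Star.  Two adjacent vertices of a graph in B(n,q) have q - 1 common
   neighbors, two other distinct vertices at most one.  Hence A^2 - (q - 1) A
   is entrywise nonnegative with row sums at most n - 1, and all row sums equal
   n - 1 exactly when any two nonadjacent vertices have a common neighbor, which
   happens only for the star; so rho (rho - q + 1) <= n - 1, with equality for
   the star only.

   Path.  Root the graph at a noncut vertex of a leaf block.  In the eigenvalue
   equation for lambda = rho, the part of the graph hanging at a vertex w
   matters only through a weight r(w), a block acts on the sum of the weights of
   its vertices by phi(t) = (t + q) / ((lambda + 2)(delta - t) + 1), where
   delta = lambda - q, and the weights of several blocks at one vertex are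
   superadditive.  Branches that are path-blocks with k blocks have weight
   r_k = phi^k(0).  The identity
     (x + phi y) - (phi x + y) = (lambda + 2)(x - y)(delta - x - phi y) / den x
   (den is the denominator of phi) gives r_{a+b} <= r_a + r_b as long as
   r_a + r_b <= delta, which always holds in a positive eigenvector.  By induction r_{b-1} <= delta in every graph with
   b blocks, whereas r_{b-1} = delta for the path-block; since r_k decreases
   and delta increases with lambda, the path-block has the smallest spectral
   radius.  Tracing the equality case back shows that all branches are paths. *)

From HB Require Import structures.
From Stdlib Require Import Classical_Prop.
Require Import Defs.
From mathcomp Require Import all_boot all_order all_algebra zify ring.

Set Implicit Arguments.
Unset Strict Implicit.
Unset Printing Implicit Defensive.

Import Order.TTheory GRing.Theory Num.Theory.

(** * Perron vectors of symmetric nonnegative matrices *)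

Section SpectralRadius.
Local Open Scope ring_scope.
Local Open Scope sesquilinear_scope.
Variable C : numClosedFieldType.

(** [C] is only partially ordered; nonnegativity makes the running maximum real, hence comparable
    with every modulus. *)
Lemma bigmax_norm_ge0 (s : seq C) : 0 <= \big[Num.max/0]_(z <- s) `|z|.
Proof.
elim/big_ind: _ => // x y x0 y0.
by rewrite /Num.max; case: ifP.
Qed.

Lemma bigmax_norm_ge (s : seq C) z :
  z \in s -> `|z| <= \big[Num.max/0]_(z <- s) `|z|.
Proof.
elim: s => // a s IH; rewrite inE big_cons => zs.
have cmp : `|a| >=< \big[Num.max/0]_(z <- s) `|z|.
  by rewrite real_comparable ?normr_real ?ger0_real ?bigmax_norm_ge0.
rewrite comparable_le_max //.
by case/predU1P: zs => [->|/IH ->]; rewrite ?lexx ?orbT.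
Qed.

Lemma bigmax_norm_attained (s : seq C) :
  s != [::] -> exists2 z, z \in s & `|z| = \big[Num.max/0]_(z <- s) `|z|.
Proof.
elim: s => // a s IH _; rewrite big_cons /Num.max.
case: ifP => [alt|_]; last by exists a; rewrite ?mem_head.
have [s0|/IH [z zs <-]] := eqVneq s [::].
  by move: alt; rewrite s0 big_nil normr_lt0.
by exists z; rewrite // in_cons zs orbT.
Qed.

Lemma mem_eigenvalues n (A : 'M[C]_n) z :
  (z \in eigenvalues A) = eigenvalue A z.
Proof.
rewrite eigenvalue_root_char /eigenvalues.
case: closed_field_poly_normal => s /= ->.
by rewrite (monicP (char_poly_monic A)) scale1r root_prod_XsubC.
Qed.

Lemma spectral_radius_ge n (A : 'M[C]_n) z :
  eigenvalue A z -> `|z| <= spectral_radius A.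
Proof. by rewrite -mem_eigenvalues; apply: bigmax_norm_ge. Qed.

Lemma spectral_radius_attained n (A : 'M[C]_n.+1) :
  exists2 z, eigenvalue A z & `|z| = spectral_radius A.
Proof.
have [|z zs ez] := @bigmax_norm_attained (eigenvalues A).
  have [z] := eigenvalue_closed A isT.
  by rewrite -mem_eigenvalues; case: eigenvalues.
by exists z; rewrite -?mem_eigenvalues.
Qed.

(** Row [i] of the unitary diagonalizing matrix is an eigenvector, nonzero because that matrix is
    invertible. *)
Lemma spectral_diag_eigenvalue n (A : 'M[C]_n) i :
  A \is normalmx -> eigenvalue A (spectral_diag A 0 i).
Proof.
move=> /orthomx_spectralP eA; apply/eigenvalueP.
exists (row i (spectralmx A)).
  rewrite {2}eA !mulmxA -!row_mul mulmxV ?spectral_unit // mul1mx row_mul.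
  suff -> : row i (diag_mx (spectral_diag A)) =
            spectral_diag A 0 i *: delta_mx 0 i.
    by rewrite -scalemxAl -rowE.
  by apply/rowP=> j; rewrite !mxE /= [j == i]eq_sym mulr_natr.
apply/eqP => r0.
have : row i (spectralmx A *m invmx (spectralmx A)) = 0.
  by rewrite row_mul r0 mul0mx.
rewrite mulmxV ?spectral_unit // => /rowP /(_ i) /eqP.
by rewrite !mxE eqxx oner_eq0.
Qed.

(* The modulus vector [w] of an eigenvector for an eigenvalue of modulus      *)
(* [r := spectral_radius A] satisfies [r w <= w A] entrywise, while           *)
(* [r 1 - A] is positive semidefinite; hence [w (r 1 - A) w^* = 0], and [w]   *)
(* lies in the kernel of [r 1 - A].                                           *)
Lemma symmetric_nonneg_eigenvector n (A : 'M[C]_n) : (0 < n)%N ->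
  A^T = A -> (forall i j, 0 <= A i j) ->
  exists w : 'rV[C]_n, [/\ w != 0, forall i, 0 <= w 0 i &
    w *m A = spectral_radius A *: w].
Proof.
case: n A => // n A _ symA A0; set r := spectral_radius A.
have rA : A \is a realmx by apply/mxOverP=> i j; apply: ger0_real.
have hermA : A \is hermsymmx.
  by apply: realsym_hermsym => //; apply/is_hermitianmxP;
     rewrite expr0 scale1r map_mx_id.
have nA := hermitian_normalmx hermA.
have [z /eigenvalueP [y yA y0] zr] := spectral_radius_attained A.
pose w : 'rV[C]_n.+1 := \row_i `|y 0 i|.
have w0 i : 0 <= w 0 i by rewrite mxE.
exists w; split=> //.
  apply: contraNneq y0 => /rowP we0; apply/eqP/rowP=> i.
  by have /eqP := we0 i; rewrite !mxE normr_eq0 => /eqP.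
have wA i : r * w 0 i <= (w *m A) 0 i.
  rewrite /r !mxE -zr -normrM; have /rowP /(_ i) := yA; rewrite !mxE => <-.
  apply: le_trans (ler_norm_sum _ _ _) _; apply: ler_sum => j _.
  by rewrite !mxE normrM (ger0_norm (A0 _ _)).
set P := spectralmx A; set d := spectral_diag A.
have uP : P \is unitarymx := spectral_unitarymx A.
have eA : A = P^t* *m diag_mx d *m P.
  by rewrite -(invmx_unitary uP); apply/orthomx_spectralP.
have PP : P^t* *m P = 1%:M.
  by rewrite -(invmx_unitary uP) mulVmx ?spectral_unit.
pose c := w *m P^t*.
pose dd := \row_i (r - d 0 i).
have eM : r%:M - A = P^t* *m diag_mx dd *m P.
  have -> : diag_mx dd = r%:M - diag_mx d.
    by apply/matrixP=> i j; rewrite !mxE; case: eqP; rewrite ?mulr1n ?mulr0n ?subr0.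
  rewrite mulmxBr mulmxBl -eA; congr (_ - _).
  by rewrite mul_mx_scalar -scalemxAl PP scalemx1.
have dd0 i : 0 <= dd 0 i.
  rewrite mxE subr_ge0; have di : d 0 i \is Num.real.
    by have /mxOverP := hermitian_spectral_diag_real hermA; apply.
  apply: le_trans (real_ler_norm di) _.
  by apply: spectral_radius_ge; apply: spectral_diag_eigenvalue.
have cstar : P *m w^t* = c^t*.
  by rewrite /c trmx_mul map_mxM map_trmx trmxK map_mxCK.
have quad : (w *m (r%:M - A) *m w^t*) 0 0 = \sum_i dd 0 i * `|c 0 i| ^+ 2.
  rewrite eM !mulmxA -/c -[_ *m P *m _]mulmxA cstar.
  rewrite mxE; apply: eq_bigr => i _.
  by rewrite mul_mx_diag normCK mulrCA mulrA; congr (_ * _); rewrite mxE // mxE.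
have quad_le0 : (w *m (r%:M - A) *m w^t*) 0 0 <= 0.
  rewrite mxE; apply: sumr_le0 => i _; apply: mulr_le0_ge0.
    by rewrite mulmxBr mul_mx_scalar !mxE subr_le0; have := wA i; rewrite !mxE.
  by rewrite !mxE conjC_ge0 normr_ge0.
have term_ge0 i : 0 <= dd 0 i * `|c 0 i| ^+ 2.
  by rewrite mulr_ge0 ?exprn_ge0.
have term0 i : dd 0 i * c 0 i = 0.
  have /eqP : \sum_i dd 0 i * `|c 0 i| ^+ 2 = 0.
    by apply/le_anti; rewrite -quad quad_le0 quad sumr_ge0.
  rewrite psumr_eq0 // => /allP /(_ i); rewrite mem_index_enum => /(_ isT).
  by rewrite /= mulf_eq0 expf_eq0 normr_eq0 /= -mulf_eq0 => /eqP.
apply/eqP; rewrite eq_sym -subr_eq0 -mul_mx_scalar -mulmxBr eM !mulmxA -/c.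
suff -> : c *m diag_mx dd = 0 by rewrite mul0mx.
by apply/rowP=> i; rewrite mul_mx_diag !mxE mulrC -[RHS](term0 i) !mxE.
Qed.

End SpectralRadius.

(** * Nonseparable subgraphs and blocks *)

Lemma connect_homo (T U : finType) (e : rel T) (e' : rel U) (h : T -> U) x y :
  (forall a b, e a b -> connect e' (h a) (h b)) ->
  connect e x y -> connect e' (h x) (h y).
Proof.
move=> hom /connectP [p]; elim: p x => [x _ ->|a p IH x /= /andP [xa pa] ly].
  exact: connect0.
exact: connect_trans (hom _ _ xa) (IH _ pa ly).
Qed.

(** Applied with [h] the inclusion of a subtype: a path that stays in the subtype is pulled back
    edge by edge. *)
Lemma connect_lift (T U : finType) (e : rel T) (e' : rel U) (h : U -> T) :
  (forall a b, e (h a) b -> exists2 b', h b' = b & e' a b') ->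
  forall x y, connect e (h x) y -> exists2 y', h y' = y & connect e' x y'.
Proof.
move=> lift x y /connectP [p].
elim: p x => [x _ ->|a p IH x /= /andP [/lift [b <- xb] pa] ly].
  by exists x.
have [y' ey by'] := IH b pa ly.
by exists y' => //; apply: connect_trans by'; apply: connect1.
Qed.

Section Connectivity.
Variable G : sgraph.

Lemma adj_connect_sym : connect_sym (@adj G).
Proof. by apply: sym_connect_sym; apply: adj_sym. Qed.

Lemma components_le1P :
  components G <= 1 <-> forall x y : G, connect adj x y.
Proof.
split=> [/card_le1_eqP le1 x y|conn].
  rewrite -(root_connect adj_connect_sym).
  by apply/eqP/le1; rewrite !inE roots_root //; apply: adj_connect_sym.
apply/card_le1_eqP=> x y; rewrite !inE !andbT => /eqP ex /eqP ey.
by rewrite -ex -ey; apply/eqP; rewrite (root_connect adj_connect_sym).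
Qed.

Lemma connectedP (x0 : G) :
  connected G <-> forall x y : G, connect adj x y.
Proof.
rewrite -components_le1P /connected; split=> [->|] // le1.
apply/eqP; rewrite eqn_leq le1; apply/card_gt0P.
by exists (fingraph.root adj x0); rewrite !inE roots_root //; apply: adj_connect_sym.
Qed.

Lemma connected_inhab : connected G -> exists x : G, True.
Proof.
move=> c1; have : 0 < components G by rewrite c1.
by case/card_gt0P=> x _; exists x.
Qed.

(** Deleting [v] is modelled on the same vertex type: its edges go and [v] stays as an isolated
    vertex. *)
Definition avoid (v : G) : rel G := [rel a b | [&& adj a b, a != v & b != v]].

Lemma avoid_sym v : connect_sym (avoid v).
Proof.
by apply: sym_connect_sym => a b; rewrite /avoid /= adj_sym [(a != v) && _]andbC.
Qed.

End Connectivity.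

(** As [G] has one component, [v] is no cut vertex when at most one component is left; the condition
    is vacuous if [v] is the only vertex. *)
Lemma cut_vertexPn (G : sgraph) (v : G) : connected G ->
  (~~ cut_vertex v <-> forall x y, x != v -> y != v -> connect (avoid v) x y).
Proof.
rewrite /cut_vertex /connected => ->; rewrite -leqNgt components_le1P.
split=> [conn x y xv yv|conn x y].
  apply: (@connect_homo _ _ _ (avoid v) val (Sub x xv) (Sub y yv)) (conn _ _).
  by move=> a b ab; apply/connect1/and3P; split;
     [exact: ab | exact: (valP a) | exact: (valP b)].
have := conn _ _ (valP x) (valP y).
move=> /(@connect_lift _ _ _ (@adj (del_vertex v)) val) [].
  by move=> a b /= /and3P [ab _ bv]; exists (Sub b bv).
by move=> y' /val_inj ->.
Qed.

Section Induced.
Variable G : sgraph.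
Implicit Types (S : {set G}) (K H : subgraph G).

Definition set_adj S : rel G := [rel a b | [&& adj a b, a \in S & b \in S]].

Fact set_adj_sym S : symmetric (set_adj S).
Proof. by move=> a b; rewrite /set_adj /= adj_sym [(a \in S) && _]andbC. Qed.

Fact set_adjP S x y : set_adj S x y -> [/\ x \in S, y \in S & adj x y].
Proof. by case/and3P. Qed.

Definition induced S : subgraph G := Subgraph (@set_adj_sym S) (@set_adjP S).

Lemma induced_nonseparable S x0 : x0 \in S ->
  {in S &, forall x y, connect (set_adj S) x y} ->
  (forall v, v \in S ->
    {in S :\ v &, forall x y, connect (set_adj (S :\ v)) x y}) ->
  nonseparable (induced S).
Proof.
move=> x0S conn conn_del.
have c1 : connected (induced S).
  apply/(@connectedP (induced S) (Sub x0 x0S)) => x y.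
  have := conn _ _ (valP x) (valP y).
  move=> /(@connect_lift _ _ _ (@adj (induced S)) val) [].
    by move=> a b ab; have /and3P [_ _ bS] := ab; exists (Sub b bS).
  by move=> y' /val_inj ->.
split=> // v; apply/cut_vertexPn => // x y xv yv.
have inD (z : induced S) : z != v -> val z \in S :\ val v.
  by move=> zv; rewrite !inE (valP z) andbT.
have := conn_del _ (valP v) _ _ (inD _ xv) (inD _ yv).
move=> /(@connect_lift _ _ _ (avoid v) val) [].
  move=> a b /and3P [ab]; rewrite !inE => /andP [av _] /andP [bv bS].
  exists (Sub b bS) => //; apply/and3P; split => //.
  by apply/and3P; split=> //; apply: (valP a).
by move=> y' /val_inj ->.
Qed.

Lemma clique_nonseparable S x0 : x0 \in S ->
  {in S &, forall x y, x != y -> adj x y} -> nonseparable (induced S).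
Proof.
have clique_connect (T : {set G}) :
    {in T &, forall x y, x != y -> adj x y} ->
    {in T &, forall x y, connect (set_adj T) x y}.
  move=> cT x y xT yT; have [->//|xy] := eqVneq x y.
  by apply/connect1/and3P; split=> //; apply: cT.
move=> x0S cS; apply: (induced_nonseparable x0S); first exact: clique_connect.
move=> v _; apply: clique_connect => x y /setD1P [_ xS] /setD1P [_ yS].
exact: cS.
Qed.

Lemma sorted_connect S s : sorted adj s -> {subset s <= S} ->
  {in s &, forall x y, connect (set_adj S) x y}.
Proof.
case: s => // a p pa sub.
have to_a : {in a :: p, forall x, connect (set_adj S) a x}.
  apply: path_connect; move: pa sub; rewrite /sorted.
  elim: p a => //= b p IH a /andP [ab pb] sub; rewrite IH //.
    by rewrite /set_adj /= ab !sub ?inE ?eqxx ?orbT.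
  by move=> z zb; apply: sub; rewrite inE zb orbT.
move=> x y xs ys; apply: connect_trans (to_a _ ys).
by rewrite (sym_connect_sym (set_adj_sym S)) to_a.
Qed.

(** Removing [w] leaves a path. Removing a vertex of that path leaves two pieces, and each nonempty
    one still contains an end adjacent to [w]. *)
Lemma cycle_nonseparable w u p :
  path adj u p -> uniq (w :: u :: p) -> adj w u -> adj w (last u p) ->
  last u p != u -> nonseparable (induced [set x in w :: u :: p]).
Proof.
move=> pp; rewrite cons_uniq => /andP [wp up] wu wl lu.
set S := [set x in _].
have wS : w \in S by rewrite !inE eqxx.
have pS x : x \in u :: p -> x \in S by move=> xp; rewrite inE in_cons xp orbT.
have symS (T : {set G}) := sym_connect_sym (set_adj_sym T).
have via_w (T : {set G}) : {in T, forall x, connect (set_adj T) x w} ->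
    {in T &, forall x y, connect (set_adj T) x y}.
  move=> toT x y xT yT; apply: connect_trans (toT _ xT) _.
  by rewrite symS toT.
have hook (T : {set G}) s z x : sorted adj s -> {subset s <= T} -> w \in T ->
    z \in s -> adj w z -> x \in s -> connect (set_adj T) x w.
  move=> ss sT wT zs wz xs; apply: connect_trans (sorted_connect ss sT xs zs) _.
  by apply/connect1/and3P; rewrite adj_sym; split=> //; apply: sT.
have last_p : last u p \in u :: p by apply: mem_last.
apply: (induced_nonseparable wS).
  apply: via_w => x; rewrite inE in_cons => /predU1P [->//|xp].
  by apply: (hook _ (u :: p) u) => //; rewrite mem_head.
move=> v; rewrite inE in_cons => /predU1P [->|vp].
  move=> x y; rewrite !inE /= => /andP [/negPf -> /= xp] /andP [/negPf -> /= yp].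
  apply: (@sorted_connect _ (u :: p)) => // z zp; rewrite !inE.
  rewrite -in_cons zp orbT andbT.
  by apply: contraNneq wp => <-.
have vw : w != v by apply: contraNneq wp => ->.
apply: via_w => x /setD1P [xv]; rewrite inE in_cons => /predU1P [->//|xp].
have wT : w \in S :\ v by rewrite !inE vw eqxx.
have sub s : {subset s <= u :: p} -> v \notin s -> {subset s <= S :\ v}.
  move=> sp vs z zs; rewrite in_setD1 (pS _ (sp _ zs)) andbT.
  by apply: contraNneq vs => <-.
have {pp} sp : sorted adj (u :: p) by [].
(* The path is about to be generalized to an arbitrary list; these equations remember its two
   ends. *)
have hd_u : head v (u :: p) = u by [].
have lst_u : last v (u :: p) = last u p by [].
move: vp sp up xp sub hd_u lst_u; move: (u :: p) => s vs.
case/splitPr: vs => s1 s2 ss us; rewrite mem_cat in_cons (negPf xv) /= => xs sub.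
move=> hd lst.
have [ss1 ss2] : sorted adj s1 /\ sorted adj s2.
  by have [-> /path_sorted] := cat_sorted2 ss.
have [v1 v2] : v \notin s1 /\ v \notin s2.
  by move: us; rewrite cat_uniq /= => /and4P [_ /norP [v1 _] v2 _].
case/orP: xs => [x1|x2].
- apply: (hook _ s1 u) => //.
    by apply: sub => // z z1; rewrite mem_cat z1.
  by move: hd x1; case: (s1) => //= a l ->; rewrite mem_head.
- apply: (hook _ s2 (last u p)) => //.
    by apply: sub => // z z2; rewrite mem_cat in_cons z2 !orbT.
  by rewrite -lst last_cat /=; move: x2; case: (s2) => //= a l _; apply: mem_last.
Qed.

Lemma nonseparable_avoid K w u1 u2 : nonseparable K ->
  w \in sub_vertices K -> u1 \in sub_vertices K -> u2 \in sub_vertices K ->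
  u1 != w -> u2 != w -> connect (avoid w) u1 u2.
Proof.
move=> [cK ncv] wK u1K u2K u1w u2w.
have /(cut_vertexPn (Sub w wK : K) cK) := ncv (Sub w wK).
move=> /(_ (Sub u1 u1K) (Sub u2 u2K) u1w u2w).
apply: (@connect_homo _ _ _ _ val) => a b /and3P [ab aw bw].
have [_ _ ab'] := sub_edgesP ab.
by apply/connect1/and3P; split.
Qed.

Lemma subgraph_le_trans K1 K2 K3 :
  subgraph_le K1 K2 -> subgraph_le K2 K3 -> subgraph_le K1 K3.
Proof.
move=> [v12 e12] [v23 e23]; split; first exact: subset_trans v12 v23.
by move=> x y /e12 /e23.
Qed.

Definition edge_set K : {set G * G} := [set e | sub_edges K e.1 e.2].

Definition subgraph_size K := #|sub_vertices K| + #|edge_set K|.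

Lemma subgraph_size_lt K H :
  subgraph_le K H -> ~ subgraph_le H K -> subgraph_size K < subgraph_size H.
Proof.
move=> [vKH eKH] nle; rewrite /subgraph_size ltnNge; apply/negP=> le.
have EKH : edge_set K \subset edge_set H.
  by apply/subsetP=> -[a b]; rewrite !inE /=; apply: eKH.
have := subset_leq_card EKH; have := subset_leq_card vKH => cV cE.
apply: nle; split.
  suff /eqP -> : sub_vertices K == sub_vertices H by [].
  by rewrite eqEcard vKH /=; lia.
move=> x y; have /setP /(_ (x, y)) : edge_set K = edge_set H.
  apply/eqP; rewrite eqEcard EKH /= -(leq_add2l #|sub_vertices H|).
  by apply: leq_trans le _; rewrite leq_add2r.
by rewrite !inE /= => ->.
Qed.

(** [subgraph_size] is bounded and grows under proper extension, so enlarging a nonseparable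
    subgraph stops at a maximal one. Being a block quantifies over all subgraphs, hence the appeal
    to [classic]. *)
Lemma extend_to_block K :
  nonseparable K -> exists2 H, is_block H & subgraph_le K H.
Proof.
have bound H : subgraph_size H <= #|G| + #|{: G * G}|.
  by rewrite leq_add ?max_card.
have [m] := ubnP (#|G| + #|{: G * G}| - subgraph_size K).
elim: m K => // m IH K lem nsK.
have [blockK|nblock] := classic (is_block K).
  by exists K => //; split.
have [H nsH [leKH nle]] : exists2 H : subgraph G, nonseparable H &
    subgraph_le K H /\ ~ subgraph_le H K.
  apply: NNPP => no; apply: nblock; split=> // H nsH leKH.
  by apply: NNPP => nle; apply: no; exists H.
have [|H' blockH' leHH'] := IH H _ nsH.
  have := subgraph_size_lt leKH nle; have := bound H; have := bound K.
  by move: lem; lia.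
by exists H' => //; apply: subgraph_le_trans leKH leHH'.
Qed.

End Induced.

(** * Block graphs as clique trees *)

Definition common_neighbors (G : sgraph) (x y : G) : {set G} :=
  [set z | adj x z && adj y z].

Definition local_chords (G : sgraph) : Prop := forall w u1 u2 : G,
  adj w u1 -> adj w u2 -> u1 != u2 -> connect (avoid w) u1 u2 -> adj u1 u2.

(* For connected graphs with at least one edge this is a description of       *)
(* block_class that does not mention blocks: [ct_chord] says that every cycle *)
(* lies in a clique, and [ct_common] that maximal cliques have q + 1 vertices.*)
Record clique_tree (q : nat) (G : sgraph) : Prop := CliqueTree {
  ct_connected : connected G;
  ct_chord : local_chords G;
  ct_common : forall x y : G, adj x y -> #|common_neighbors x y| = q.-1 }.

Lemma adj_neq (G : sgraph) (x y : G) : adj x y -> x != y.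
Proof. by apply: contraTneq => ->; rewrite adj_irrefl. Qed.

(** Two common neighbors of [x] and [y] are neighbors of [x] joined through [y], so the chord
    condition at [x] makes them adjacent. *)
Lemma edge_clique (G : sgraph) (x y : G) : local_chords G -> adj x y ->
  {in x |: (y |: common_neighbors x y) &, forall a b, a != b -> adj a b}.
Proof.
move=> chord xy a b; rewrite !inE.
case/or3P=> [/eqP ->|/eqP ->|/andP [xa ya]];
  case/or3P=> [/eqP ->|/eqP ->|/andP [xb yb]]; rewrite ?eqxx // => ab;
  try by rewrite // adj_sym.
apply: (chord x) => //; apply: (@connect_trans _ _ y); apply: connect1.
  by rewrite /avoid /= adj_sym ya ![_ == x]eq_sym !adj_neq.
by rewrite /avoid /= yb ![_ == x]eq_sym !adj_neq.
Qed.

Lemma card_sub_vertices (G : sgraph) (H : subgraph G) :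
  #|H| = #|sub_vertices H|.
Proof. by rewrite card_sig. Qed.

Section BlockClass.
Variables (n q : nat) (G : sgraph).
Hypotheses (q_gt0 : 0 < q) (bG : block_class n q G).

Lemma nonseparable_clique (K : subgraph G) : nonseparable K ->
  {in sub_vertices K &, forall x y, x != y -> adj x y}.
Proof.
move=> /extend_to_block [H bH [/subsetP leKH _]] x y xK yK xy.
have [[_ complH] _ _] := bG.
have := complH H bH (Sub x (leKH _ xK)) (Sub y (leKH _ yK)).
by rewrite -val_eqE => /(_ xy) /(sub_edgesP (s := H)) [].
Qed.

(** A single vertex is nonseparable, so it extends to a block, which has [q.+1] vertices. *)
Lemma block_class_card_gt1 : 1 < n.
Proof.
have [[cG _] <- cardH] := bG.
have [x _] := connected_inhab cG.
have /extend_to_block [H bH _] : nonseparable (induced [set x]).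
  apply: (@clique_nonseparable _ _ x); first by rewrite inE.
  by move=> y z; rewrite !inE => /eqP -> /eqP ->; rewrite eqxx.
apply: leq_trans (max_card (mem (sub_vertices H))).
by rewrite -card_sub_vertices cardH.
Qed.

Lemma block_class_clique_tree : clique_tree q G.
Proof.
(* A shortest form of the path from [u1] to [u2] closes up through [w] to a cycle, which lies in a
   block and so spans a clique. *)
have chord : local_chords G.
  move=> w u1 u2 w1 w2 u12 /connectP [p0 pp0 ep0].
  case/shortenP: pp0 ep0 => p pp up _ ep.
  have wp : w \notin u1 :: p.
    rewrite in_cons (negPf (adj_neq w1)) /=.
    elim: p u1 pp {up w1 u12 ep} => //= a p IH u1 /andP [/and3P [_ _ aw] pp].
    by rewrite in_cons eq_sym (negPf aw) (IH a).
  have cyc : nonseparable (induced [set x in w :: u1 :: p]).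
    apply: cycle_nonseparable => //; first 1 last.
    - by rewrite cons_uniq wp.
    - by rewrite -ep.
    - by rewrite -ep eq_sym.
    by apply: sub_path pp => a b /and3P [].
  apply: (nonseparable_clique cyc) => //; rewrite inE in_cons.
    by rewrite mem_head orbT.
  by rewrite ep mem_last orbT.
have [[cG _] _ cardH] := bG.
split=> // x y xy.
(* The clique [S] lies in a block [H]; as [H] is a clique too, its other vertices are common
   neighbors of [x] and [y]. So [H] has vertex set [S], and counting gives [q.-1]. *)
pose S := x |: (y |: common_neighbors x y).
have clS := edge_clique chord xy.
have xS : x \in S by rewrite !inE eqxx.
have /extend_to_block [H bH [/subsetP leSH _]] := clique_nonseparable xS clS.
have nsH : nonseparable H by case: bH.
have clH := nonseparable_clique nsH.
have yS : y \in S by rewrite !inE eqxx orbT.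
have eHS : sub_vertices H = S.
  apply/setP=> z; apply/idP/idP=> [zH|/leSH //].
  rewrite !inE; have [//|zx] := eqVneq z x; have [//|zy] := eqVneq z y.
  by apply/andP; split; apply: clH => //; rewrite ?leSH // eq_sym.
have := cardH H bH; rewrite card_sub_vertices eHS /S !cardsU1 !inE.
rewrite (negPf (adj_neq xy)) !adj_irrefl /= andbF /=.
by case: (q) => //; lia.
Qed.

End BlockClass.

Section CliqueTreeBlocks.
Variables (q : nat) (G : sgraph).
Hypotheses (q_gt0 : 0 < q) (cG : clique_tree q G) (G_gt1 : 1 < #|G|).

(** Adjacency to [x] propagates along a path of [K]: for an edge from [b] to [y] with [b] adjacent
    to [x], the vertices [x] and [y] are connected off [b] since [b] is no cut vertex of [K], and
    the chord condition at [b] applies. *)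
Lemma clique_tree_nonseparable (K : subgraph G) : nonseparable K ->
  {in sub_vertices K &, forall x y, x != y -> adj x y}.
Proof.
move=> nsK.
suff main (x y : K) : connect adj x y -> val x != val y -> adj (val x) (val y).
  move=> x y xK yK; apply: (main (Sub x xK) (Sub y yK)).
  exact: (proj1 (connectedP (Sub x xK : K)) (proj1 nsK)).
rewrite (sym_connect_sym (@adj_sym K)) => /connectP [p].
elim: p y => [y _ -> /eqP //|b p IH y /= /andP [yb pb] ex xy].
have [_ _ yb'] := sub_edgesP yb.
have [xb|xb] := eqVneq (val x) (val b); first by rewrite adj_sym xb.
have xb' := IH _ pb ex xb.
apply: (ct_chord cG (w := val b)) => //; first by rewrite adj_sym.
  by rewrite adj_sym.
apply: (nonseparable_avoid nsK) => //; try exact: valP.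
by rewrite (adj_neq yb').
Qed.

(** The clique induced on [S] is nonseparable and contains [H], so maximality identifies both
    vertices and edges. *)
Lemma block_eq_induced (H : subgraph G) (S : {set G}) x0 : is_block H ->
  x0 \in S -> {in S &, forall x y, x != y -> adj x y} ->
  sub_vertices H \subset S ->
  sub_vertices H = S /\ complete H.
Proof.
move=> [nsH maxH] x0S clS HS.
have [|SH eSH] := maxH _ (clique_nonseparable x0S clS).
  split=> // x y /sub_edgesP [xH yH xy].
  by apply/and3P; split=> //; apply: (subsetP HS).
split=> [|x y xy]; first by apply/eqP; rewrite eqEsubset HS.
have xS := subsetP HS _ (valP x); have yS := subsetP HS _ (valP y).
by apply: eSH; apply/and3P; split=> //; apply: clS.
Qed.

Lemma clique_tree_has_neighbor (x : G) : exists y, adj x y.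
Proof.
have /card_gt0P [y] : 0 < #|[set~ x]| by rewrite cardsC1; lia.
rewrite !inE => yx; have /(connectedP x) /(_ x y) := ct_connected cG.
case/connectP=> -[_ ey|z p /= /andP [xz _] _]; last by exists z.
by rewrite ey eqxx in yx.
Qed.

Lemma clique_tree_block_class : block_class #|G| q G.
Proof.
have block_in (H : subgraph G) : is_block H ->
    exists x y, adj x y /\
      sub_vertices H \subset x |: (y |: common_neighbors x y).
  move=> bH; have [nsH _] := bH.
  have clH := clique_tree_nonseparable nsH.
  have [[x xH] _] := connected_inhab (proj1 nsH).
  (* A one-vertex [H] is placed in the clique of any edge at its vertex. *)
  have [/subsetP sub|/subsetPn [y yH yx]] := boolP (sub_vertices H \subset [set x]).
    have [y xy] := clique_tree_has_neighbor x; exists x, y; split=> //.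
    by apply/subsetP=> z /sub; rewrite !inE => ->.
  rewrite inE eq_sym in yx; exists x, y; split; first exact: clH.
  apply/subsetP=> z zH; rewrite !inE.
  have [//|zx] := eqVneq z x; have [//|zy] := eqVneq z y.
  by rewrite !clH // eq_sym.
have block_eq (H : subgraph G) : is_block H ->
    (exists x y, adj x y /\ sub_vertices H = x |: (y |: common_neighbors x y))
    /\ complete H.
  move=> bH; have [x [y [xy sub]]] := block_in H bH.
  have clS := edge_clique (ct_chord cG) xy.
  have [eH cH] := block_eq_induced bH (setU11 x _) clS sub.
  by split=> //; exists x, y.
split=> //.
- by split; [exact: ct_connected cG | move=> H /block_eq []].
- move=> H /block_eq [[x [y [xy eH]]] _].
  rewrite card_sub_vertices eH !cardsU1 !inE.
  rewrite (negPf (adj_neq xy)) !adj_irrefl /= andbF (ct_common cG xy) /=.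
  by move: q_gt0; lia.
Qed.

End CliqueTreeBlocks.

(** * The star and the path-block are clique trees *)

Lemma connect_invariant (T : finType) (e : rel T) (P : pred T) x y :
  (forall a b, e a b -> P a -> P b) -> connect e x y -> P x -> P y.
Proof.
move=> inv /connectP [p pp ->]; elim: p x pp => //= a p IH x /andP [xa pa] Px.
exact: IH pa (inv _ _ xa Px).
Qed.

Lemma card_common_neighbors (G : sgraph) (q : nat) (x y : G) (B : {set G}) :
  adj x y -> #|B| = q.+1 -> x |: (y |: common_neighbors x y) = B ->
  #|common_neighbors x y| = q.-1.
Proof.
move=> xy cB eB; move: cB; rewrite -eB !cardsU1 !inE (negPf (adj_neq xy)).
by rewrite !adj_irrefl /= andbF /=; lia.
Qed.

(** A passage through [v] can be replaced by the edge between the two neighbors used. *)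
Lemma simplicial_not_cut (G : sgraph) (v : G) : connected G ->
  (forall a b, adj v a -> adj v b -> a != b -> adj a b) -> ~~ cut_vertex v.
Proof.
move=> cG simp; apply/cut_vertexPn => // x y xv yv.
have sym_v := avoid_sym v.
(* [Z] is the component of [x] off [v] with [v] added; it is closed under adjacency once it contains
   a neighbor of [v]. *)
pose Z := [pred z | (z == v) || connect (avoid v) x z].
suff : Z y by rewrite /= (negPf yv).
have conn := proj1 (connectedP x) cG.
have step z c : connect (avoid v) x z -> z != v -> c != v -> adj z c ->
    connect (avoid v) x c.
  by move=> xz zv cv zc; apply: connect_trans xz (connect1 _); apply/and3P.
case: (boolP [exists a, adj v a && connect (avoid v) x a]).
  case/existsP=> a /andP [va xa].
  have av : a != v by rewrite eq_sym adj_neq.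
  have nbr c : adj v c -> connect (avoid v) x c.
    move=> vc; have [<-//|ac] := eqVneq a c.
    by apply: (step a) => //; [rewrite eq_sym adj_neq | apply: simp].
  apply: connect_invariant (conn x y) _; last by rewrite /= connect0 orbT.
  move=> z c zc /= Zz; have [//|cv] := eqVneq c v; move: Zz.
  have [zv _|zv xz] := eqVneq z v; first by apply: nbr; rewrite -zv.
  exact: (step z).
(* If the component of [x] off [v] contains no neighbor of [v], then [x] cannot reach [v], against
   connectedness. *)
move=> /existsPn no.
have xNv z : connect (avoid v) x z -> z != v.
  by move=> xz; apply: (connect_invariant (P := predC1 v) _ xz xv) => a d /and3P [].
have : connect (avoid v) x v.
  apply: (connect_invariant (P := connect (avoid v) x)) (conn x v) (connect0 _ _).
  move=> z c zc xz.
  have [cv|cv] := eqVneq c v; last by apply: (step z) => //; apply: xNv.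
  by have /negP [] := no z; rewrite xz andbT adj_sym -cv.
by move=> /xNv; rewrite eqxx.
Qed.

Section Star.
Variables q b : nat.
Local Notation S := (star_block q b).

Lemma star_center_adj (x : S) : x != None -> @adj S None x.
Proof. by case: x. Qed.

Lemma star_clique_tree : clique_tree q S.
Proof.
have cS : connected S.
  apply/(@connectedP S None) => x y; apply: (@connect_trans _ _ None).
    by have [->//|xN] := eqVneq x None; apply: connect1; rewrite adj_sym star_center_adj.
  by have [->//|yN] := eqVneq y None; apply/connect1/star_center_adj.
pose B (k : 'I_b) : {set S} := [set o : S | if o is Some z then z.1 == k else true].
have clB k (x y : S) : x \in B k -> y \in B k -> x != y -> adj x y.
  rewrite !inE /adj /= /star_adj => xB yB ->; move: xB yB.
  by case: x y => [[? ?]|] [[? ?]|] //= /eqP -> /eqP ->; rewrite eqxx.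
have cB k : #|B k| = q.+1.
  have -> : B k = [set omap (pair k) i | i : option 'I_q].
    apply/setP=> -[[l i]|]; rewrite inE /=; apply/idP/imsetP => //.
    - by move=> /eqP ->; exists (Some i).
    - by move=> [[j|] _ //= [-> _]].
    - by exists None.
  rewrite card_imset ?card_option ?card_ord //.
  by move=> [i|] [j|] //= [->].
have inB (x y : S) : adj x y -> exists k, (x \in B k) && (y \in B k).
  rewrite /adj /= /star_adj; case: x y => [[k i]|] [[l j]|] //=.
  - by case/andP=> _ kl; exists k; rewrite !inE /= eqxx eq_sym.
  - by exists k; rewrite !inE /= eqxx.
  - by exists l; rewrite !inE /= eqxx.
(* A block can be left only through the center, so it is invariant under paths avoiding [None]. *)
have sameB k (x y : S) : x \in B k -> x != None -> adj x y -> y \in B k.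
  rewrite !inE /adj /= /star_adj.
  by case: x y => [[? ?]|] [[? ?]|] //= /eqP -> _ /andP [_ /eqP ->].
split=> //.
- move=> w u1 u2 w1 w2 u12 conn.
  have [k /andP [wk uk]] := inB _ _ w1; have [l /andP [wl ul]] := inB _ _ w2.
  suff u2k : u2 \in B k by apply: (clB k).
  case: w w1 w2 conn wk wl => [[m i]|] w1 w2 conn.
    by rewrite !inE /= => /eqP mk /eqP ml; move: ul; rewrite inE -mk ml.
  move=> _ _; apply: (connect_invariant (P := mem (B k))) conn uk => x y.
  by case/and3P=> xy xN _ xk; apply: sameB xk xN xy.
- move=> x y xy; have [k /andP [xk yk]] := inB _ _ xy.
  apply: (card_common_neighbors xy (cB k)).
  apply/setP=> z; rewrite !in_setU1 [z \in common_neighbors _ _]inE.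
  apply/idP/idP => [|zk].
    case/or3P=> [/eqP -> //|/eqP -> //|/andP [xz yz]].
    have [xN|xN] := eqVneq x None; last exact: sameB xk xN xz.
    by apply: sameB yk _ yz; rewrite -xN eq_sym adj_neq.
  have [//|zx] := eqVneq z x; have [//|zy] := eqVneq z y.
  by apply/andP; split; apply: (clB k) => //; rewrite eq_sym.
Qed.

Lemma card_star : #|S| = (b * q).+1.
Proof. by rewrite card_option card_prod !card_ord. Qed.

End Star.

Section Path.
Variables q b : nat.
Hypothesis q_gt0 : 0 < q.
Local Notation P := (path_block q b).

Definition interval_block (k : nat) : {set P} :=
  [set x : P | k * q <= x <= k.+1 * q].

Lemma path_adjE (x y : P) : adj x y = (x != y) &&
  [exists k : 'I_b, (x \in interval_block k) && (y \in interval_block k)].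
Proof.
rewrite /adj /= /path_adj; congr (_ && _).
by apply: eq_existsb => k; rewrite !inE.
Qed.

Lemma path_adjP (x y : P) : adj x y -> exists k, [/\ (k < b)%N,
  x \in interval_block k, y \in interval_block k & x != y].
Proof.
by rewrite path_adjE => /andP [xy /existsP [k /andP [xk yk]]]; exists k.
Qed.

Lemma path_adjI k (x y : P) : k < b -> x \in interval_block k ->
  y \in interval_block k -> x != y -> adj x y.
Proof.
move=> kb xk yk xy; rewrite path_adjE xy; apply/existsP.
by exists (Ordinal kb); rewrite xk yk.
Qed.

(** From [l * q <= x <= k.+1 * q] and [k < l] it follows that [l = k.+1], and both inequalities
    become equalities. *)
Lemma interval_block_lt k l (x : P) :
  x \in interval_block k -> x \in interval_block l -> k < l ->
  l = k.+1 /\ x = k.+1 * q :> nat.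
Proof.
rewrite !inE => /andP [_ xk] /andP [xl _] kl.
have := leq_trans xl xk; rewrite leq_pmul2r // => lk.
have el : l = k.+1 by apply/eqP; rewrite eqn_leq lk.
by split=> //; apply/eqP; rewrite eqn_leq xk -el xl.
Qed.

Lemma interval_block_eq k l (x y : P) : x != y ->
  x \in interval_block k -> x \in interval_block l ->
  y \in interval_block k -> y \in interval_block l -> k = l.
Proof.
move=> xy xk xl yk yl; case: (ltngtP k l) => // kl; case/negP: xy.
  have [_ ex] := interval_block_lt xk xl kl.
  have [_ ey] := interval_block_lt yk yl kl.
  by apply/eqP/val_inj; rewrite /= ex ey.
have [_ ex] := interval_block_lt xl xk kl.
have [_ ey] := interval_block_lt yl yk kl.
by apply/eqP/val_inj; rewrite /= ex ey.
Qed.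

Lemma card_interval_block k : k < b -> #|interval_block k| = q.+1.
Proof.
move=> kb; pose f (i : 'I_q.+1) : P := inord (k * q + i).
have lt_bq (i : 'I_q.+1) : k * q + i < (b * q).+1.
  have : k.+1 * q <= b * q by rewrite leq_mul2r kb orbT.
  by have := ltn_ord i; rewrite mulSn; lia.
have fE i : f i = k * q + i :> nat by rewrite inordK.
have -> : interval_block k = [set f i | i : 'I_q.+1].
  apply/setP=> x; apply/idP/imsetP=> [|[i _ ->]].
    rewrite inE => /andP [kx xk].
    have lt : x - k * q < q.+1 by move: xk; rewrite mulSn; lia.
    by exists (Ordinal lt) => //; apply/val_inj; rewrite /= fE /= subnKC.
  by rewrite inE fE mulSn; have := ltn_ord i; lia.
rewrite card_imset ?card_ord // => i j /(congr1 val) /=.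
by rewrite !fE => /addnI /val_inj.
Qed.

Lemma path_connected : connected P.
Proof.
have sym := sym_connect_sym (@adj_sym P).
have to0 (x : P) : connect adj (ord0 : P) x.
  case: x => m; elim: m => [|m IH] lt.
    by rewrite (_ : Ordinal lt = ord0) //; apply/val_inj.
  apply: connect_trans (IH (ltnW lt)) (connect1 _).
  (* Both [m] and [m.+1] lie in the block with index [m %/ q]. *)
  have mb : m %/ q < b by rewrite ltn_divLR //; lia.
  apply: (path_adjI mb); last by rewrite -val_eqE /=; lia.
    rewrite inE /= leq_trunc_div /= mulSn.
    by have := divn_eq m q; have := ltn_pmod m q_gt0; lia.
  rewrite inE /= mulSn; have := leq_trunc_div m q.
  by have := divn_eq m q; have := ltn_pmod m q_gt0; lia.
apply/(@connectedP P ord0) => x y.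
by apply: connect_trans (to0 y); rewrite sym.
Qed.

(** Here [w = k.+1 * q]. An edge starting below [w] lies in a block of index at most [k], so a path
    avoiding [w] never gets above it. *)
Lemma path_separated (w u1 u2 : P) k l : k < l ->
  w \in interval_block k -> u1 \in interval_block k -> u1 != w ->
  w \in interval_block l -> u2 \in interval_block l ->
  ~ connect (avoid w) u1 u2.
Proof.
move=> kl wk uk u1w wl ul conn.
have [el ew] := interval_block_lt wk wl kl.
have uw : u1 < w.
  rewrite ltn_neqAle val_eqE u1w /= ew.
  by move: uk; rewrite inE => /andP [].
have : u2 < w.
  apply: (connect_invariant (P := [pred x : P | x < w])) conn uw => x y.
  case/and3P=> /path_adjP [j [_ xj yj _]] _ yw xw.
  have jk : j <= k.
    move: xj; rewrite inE => /andP [jx _]; have := leq_ltn_trans jx xw.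
    by rewrite ew ltn_pmul2r.
  rewrite /= ltn_neqAle val_eqE yw /= ew.
  move: yj; rewrite inE => /andP [_ yj]; apply: leq_trans yj _.
  by rewrite leq_pmul2r.
by move: ul; rewrite inE el -ew => /andP [wu _]; rewrite ltnNge wu.
Qed.

Lemma path_clique_tree : clique_tree q P.
Proof.
split; first exact: path_connected.
- move=> w u1 u2 /path_adjP [k [kb wk uk w1]] /path_adjP [l [lb wl ul w2]] u12 c.
  case: (ltngtP k l) => kl.
  + by case: (path_separated kl wk uk _ wl ul c); rewrite eq_sym.
  + rewrite avoid_sym in c.
    by case: (path_separated kl wl ul _ wk uk c); rewrite eq_sym.
  + by apply: (path_adjI kb) => //; rewrite kl.
- move=> x y xy; have [k [kb xk yk xNy]] := path_adjP xy.
  apply: (card_common_neighbors xy (card_interval_block kb)).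
  apply/setP=> z; rewrite !in_setU1 [z \in common_neighbors _ _]inE.
  apply/idP/idP => [|zk].
    case/or3P=> [/eqP -> //|/eqP -> //|/andP []].
    move=> /path_adjP [l [_ xl zl xz]] /path_adjP [m [_ ym zm yz]].
    have [<- //|lk] := eqVneq l k; have [<- //|mk] := eqVneq m k.
    have [lm|lm] := eqVneq l m.
      by rewrite -lm in ym; case/eqP: lk; apply: interval_block_eq xNy _ _ _ _.
    (* If [l] and [m] are on the same side of [k], then [x] and [y] are the same end of block [k];
       otherwise [z] would lie on both sides of that block. *)
    exfalso; move: xk yk xl zl ym zm; rewrite !inE.
    have mono i j : i < j -> i.+1 * q <= j * q by move=> ?; rewrite leq_mul2r; lia.
    have nx : x != y :> nat by rewrite val_eqE.
    case: (ltngtP l k) lk => // lk _; case: (ltngtP m k) mk => // mk _;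
      have := mono _ _ lk; have := mono _ _ mk; rewrite !mulSn; lia.
  have [//|zx] := eqVneq z x; have [//|zy] := eqVneq z y.
  by apply/andP; split; apply: (path_adjI kb) => //; rewrite eq_sym.
Qed.

Lemma card_path : #|P| = (b * q).+1.
Proof. by rewrite card_ord. Qed.

(** A vertex that is no multiple of [q] lies in one block only, so its neighbors form a clique. *)
Lemma path_cut_vertex (x : P) : cut_vertex x -> exists k, x = k * q :> nat.
Proof.
move=> cx; have [/dvdnP //|nqx] := boolP (q %| x).
suff : ~~ cut_vertex x by rewrite cx.
apply: simplicial_not_cut path_connected _ => u1 u2.
move=> /path_adjP [k [kb xk uk _]] /path_adjP [l [lb xl ul _]].
suff kl : k = l by apply: (path_adjI kb) => //; rewrite kl.
case: (ltngtP k l) => // kl; case/negP: nqx.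
  by have [_ ->] := interval_block_lt xk xl kl; rewrite dvdn_mull.
by have [_ ->] := interval_block_lt xl xk kl; rewrite dvdn_mull.
Qed.

Lemma path_at_most_3 : at_most_3_adjacent_cut_vertices P.
Proof.
move=> K cutK clK; have [->|/set0Pn [x xK]] := eqVneq K set0.
  by rewrite cards0.
(* Adjacent multiples of [q] differ by exactly [q]. An argument of [inord] out of range yields
   [ord0], which does not affect the bound. *)
suff /subset_leq_card : K \subset [set (inord (x - q) : P); x; inord (x + q)].
  move=> le; apply: leq_trans le (leq_trans (leq_card_setU _ _) _).
  by rewrite cards1 cards2; case: (_ != _).
apply/subsetP=> y yK; rewrite !inE.
have [//|yx] := eqVneq y x; first by rewrite orbT.
have [i ex] := path_cut_vertex (cutK _ xK).
have [j ey] := path_cut_vertex (cutK _ yK).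
have [k [kb xk yk _]] := path_adjP (clK _ _ yK xK yx).
have nx : y != x :> nat by rewrite val_eqE.
have kij m : k * q <= m * q <= k.+1 * q -> m = k \/ m = k.+1.
  by rewrite !leq_pmul2r //; lia.
move: xk yk; rewrite !inE => yk xk.
have [ei|ei] : i = k \/ i = k.+1 by apply: kij; rewrite -ex.
  have [ej|ej] : j = k \/ j = k.+1 by apply: kij; rewrite -ey.
    by case/eqP: nx; rewrite ex ey ei ej.
  apply/orP; right; apply/eqP/val_inj; rewrite /= -[LHS]/(y : nat).
  by have := ltn_ord y; rewrite ey ej mulSn ex ei => lt; rewrite inordK; lia.
have [ej|ej] : j = k \/ j = k.+1 by apply: kij; rewrite -ey.
  apply/orP; left; apply/orP; left; apply/eqP/val_inj; rewrite /= -[LHS]/(y : nat).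
  by have := ltn_ord x; rewrite ey ej ex ei mulSn => lt; rewrite inordK; lia.
by case/eqP: nx; rewrite ex ey ei ej.
Qed.

End Path.

(** * Rooted clique trees *)

(* The clique tree seen from a root: [lvl] is the distance to the root, [par x]
   the unique neighbor of x that is closer to the root, and [cls x] a canonical
   representative of the block of x and [par x] without [par x] (the class of
   the root is the root alone). *)
Record rooting (q : nat) (G : sgraph) (v0 : G) : Type := Rooting {
  lvl : G -> nat;
  par : G -> G;
  cls : G -> G;
  lvl_eq0 : forall x, (lvl x == 0) = (x == v0);
  lvl_par : forall x, x != v0 -> lvl x = (lvl (par x)).+1;
  cls_idem : forall x, cls (cls x) = cls x;
  cls_root : forall x, (cls x == v0) = (x == v0);
  cls_par : forall x y, cls x = cls y -> par x = par y;
  rooting_adj : forall x y, adj x y = (x != y) &&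
    [|| cls x == cls y, (x != v0) && (par x == y) | (y != v0) && (par y == x)];
  card_cls : forall x, x != v0 -> #|[set y | cls y == cls x]| = q }.

Section RootingExists.
Variables (q : nat) (G : sgraph) (v0 : G).
Hypotheses (q_gt0 : 0 < q) (cG : clique_tree q G).

Fixpoint walk k (x : G) : bool :=
  if k is k'.+1 then [exists y, walk k' y && adj y x] else x == v0.

Fact walkS k x : walk k.+1 x = [exists y, walk k y && adj y x].
Proof. by []. Qed.

Fact walk_exists x : exists k, walk k x.
Proof.
have := proj1 (connectedP v0) (ct_connected cG) x v0.
case/connectP=> p; elim: p x => [x _ /= <-|y p IH x /= /andP [xy py] e].
  by exists 0; rewrite /= eqxx.
have [k wk] := IH y py e; exists k.+1; rewrite walkS; apply/existsP; exists y.
by rewrite wk adj_sym.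
Qed.

Definition dist x := ex_minn (walk_exists x).

Lemma dist_min k x : walk k x -> dist x <= k.
Proof. by rewrite /dist; case: ex_minnP => m _; apply. Qed.

Lemma dist_walk x : walk (dist x) x.
Proof. by rewrite /dist; case: ex_minnP. Qed.

Lemma dist_eq0 x : (dist x == 0) = (x == v0).
Proof.
apply/eqP/eqP => [e|->]; first by have := dist_walk x; rewrite e => /= /eqP.
by apply/eqP; rewrite -leqn0; apply: dist_min => /=.
Qed.

Lemma dist_adj x y : adj x y -> dist y <= (dist x).+1.
Proof.
by move=> xy; apply: dist_min; rewrite walkS; apply/existsP; exists x; rewrite dist_walk.
Qed.

Definition parent x := odflt v0 [pick y | adj x y && (dist x == (dist y).+1)].

Lemma parentP x : x != v0 -> adj x (parent x) /\ dist x = (dist (parent x)).+1.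
Proof.
rewrite -dist_eq0 => dx; rewrite /parent; case: pickP => [y /andP [xy /eqP e] //|no].
case e: (dist x) dx (dist_walk x) => [//|k] _.
rewrite walkS => /existsP [y /andP [wy yx]].
have := no y; rewrite adj_sym yx /= e eqSS eq_sym eqn_leq dist_min //=.
by have := dist_adj yx; rewrite e ltnS => ->.
Qed.

(** Following parents from [x] strictly lowers the distance, so the walk to [v0] stays off [w]. *)
Lemma connect_root w x : w != v0 -> x != w -> dist x <= dist w ->
  connect (avoid w) x v0.
Proof.
move=> wv; have [m] := ubnP (dist x); elim: m x => // m IH x lem xw le.
have [->//|xv] := eqVneq x v0.
have [xp dxp] := parentP xv.
have pw : parent x != w by apply: contraTneq le => <-; rewrite dxp -ltnNge.
apply: connect_trans (connect1 _) (IH (parent x) _ pw _); first exact/and3P.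
  by rewrite -ltnS -dxp.
by rewrite ltnW // -dxp.
Qed.

Lemma connect_below w x y : w != v0 -> x != w -> y != w ->
  dist x <= dist w -> dist y <= dist w -> connect (avoid w) x y.
Proof.
move=> wv xw yw xle yle; apply: connect_trans (connect_root wv xw xle) _.
by rewrite avoid_sym connect_root.
Qed.

(** The two claims support each other in one induction on the level. Two distinct parents of [w] are
    joined off [w] via the root, so they are adjacent and share a parent; the chord condition at one
    of them makes that grandparent adjacent to [w], two levels away. For adjacent [w1] and [w2] on
    one level, the chord condition at [w1] makes the parent of [w1] adjacent to [w2], and uniqueness
    applies. *)
Lemma parent_unique_and_same_level l :
  (forall w u, dist w = l -> adj w u -> dist w = (dist u).+1 -> u = parent w) /\
  (forall w1 w2, dist w1 = l -> adj w1 w2 -> dist w2 = l ->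
     parent w1 = parent w2).
Proof.
elim: l => [|l [uniq_l same_l]].
  split=> [w u -> //|w1 w2 /eqP + + /eqP].
  by rewrite !dist_eq0 => /eqP -> + /eqP ->.
have uniq : forall w u, dist w = l.+1 -> adj w u -> dist w = (dist u).+1 ->
    u = parent w.
  move=> w u dw wu du.
  have wv : w != v0 by rewrite -dist_eq0 dw.
  have [wp dp] := parentP wv.
  have du' : dist u = l by move: du; rewrite dw => -[].
  have dp' : dist (parent w) = l by move: dp; rewrite dw => -[].
  apply/eqP; apply/negPn/negP => up.
  have u_p : adj u (parent w).
    apply: (ct_chord cG wu wp up); apply: connect_below => //.
    - by rewrite eq_sym adj_neq.
    - by rewrite eq_sym adj_neq.
    - by rewrite du' dw.
    - by rewrite dp' dw.
  have uv : u != v0.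
    apply: contraNneq up => uv; rewrite eq_sym uv -dist_eq0 dp' -du'.
    by rewrite dist_eq0 uv.
  have [ua da] := parentP uv.
  have ea := same_l _ _ du' u_p dp'.
  have pv : parent w != v0 by rewrite -dist_eq0 dp' -du' dist_eq0.
  have [pa _] := parentP pv; rewrite -ea in pa.
  have aw : adj (parent u) w.
    apply: (ct_chord cG ua); first by rewrite adj_sym.
      by apply/eqP => e; move: da; rewrite e dw du'; lia.
    apply: (@connect_trans _ _ (parent w)); apply/connect1/and3P; split.
    + by rewrite adj_sym.
    + by rewrite eq_sym adj_neq.
    + by rewrite eq_sym.
    + by rewrite adj_sym.
    + by rewrite eq_sym.
    + by rewrite adj_neq.
  by have := dist_adj aw; rewrite dw -da du' ltnn.
split=> // w1 w2 d1 w12 d2.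
have v1 : w1 != v0 by rewrite -dist_eq0 d1.
have v2 : w2 != v0 by rewrite -dist_eq0 d2.
have [p1 dp1] := parentP v1; have [p2 dp2] := parentP v2.
apply: uniq => //; last by rewrite d2 -d1.
apply: (ct_chord cG w12 p1); first by apply/eqP=> e; move: dp1; rewrite -e d1 d2; lia.
apply: connect_below => //; rewrite ?d1 ?d2 //; try by rewrite eq_sym adj_neq.
by move: dp1; rewrite d1; lia.
Qed.

Lemma parent_unique w u : adj w u -> dist w = (dist u).+1 -> u = parent w.
Proof. by have [H _] := parent_unique_and_same_level (dist w); apply: H. Qed.

Lemma same_level_parent w1 w2 : adj w1 w2 -> dist w1 = dist w2 ->
  parent w1 = parent w2.
Proof.
by move=> w12 e; have [_ H] := parent_unique_and_same_level (dist w1); apply: H.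
Qed.

Definition sib x y := (x == y) || (adj x y && (dist x == dist y)).

Lemma sib_sym x y : sib x y = sib y x.
Proof. by rewrite /sib eq_sym adj_sym [dist y == _]eq_sym. Qed.

Lemma sib_dist x y : sib x y -> dist x = dist y.
Proof. by case/predU1P=> [->//|/andP [_ /eqP]]. Qed.

Lemma sib_root x : sib v0 x = (x == v0).
Proof.
rewrite /sib eq_sym; case: eqVneq => //= xv.
by rewrite eq_sym; move: (dist_eq0 v0); rewrite eqxx => /eqP ->;
   rewrite dist_eq0 (negPf xv) andbF.
Qed.

Lemma sib_parent x y : sib x y -> parent x = parent y.
Proof.
case/predU1P=> [->//|/andP [xy /eqP e]]; exact: same_level_parent.
Qed.

(** Both [x] and [z] are neighbors of [y], joined off [y] through the common parent. *)
Lemma sib_trans x y z : sib x y -> sib y z -> sib x z.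
Proof.
move=> xy yz; have exy := sib_dist xy; have eyz := sib_dist yz.
have pxy := sib_parent xy; have pyz := sib_parent yz.
move: xy yz; have [-> //|xy /=] := eqVneq x y; have [<- //|yz /=] := eqVneq y z.
rewrite /sib (negPf xy) (negPf yz) /= => /andP [axy _] /andP [ayz _].
have [//|xz /=] := eqVneq x z; rewrite exy eyz eqxx andbT.
have yv : y != v0.
  apply: contraNneq xy => yv; rewrite yv -dist_eq0 exy dist_eq0.
  by rewrite yv.
have xv : x != v0 by rewrite -dist_eq0 exy dist_eq0.
have zv : z != v0 by rewrite -dist_eq0 -eyz dist_eq0.
have [px _] := parentP xv; have [pz _] := parentP zv; have [py _] := parentP yv.
rewrite adj_sym in axy; apply: (ct_chord cG axy ayz xz).
apply: (@connect_trans _ _ (parent y)); apply/connect1/and3P; split=> //.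
- by rewrite -pxy.
- by rewrite eq_sym adj_neq.
- by rewrite pyz adj_sym.
- by rewrite eq_sym adj_neq.
- by rewrite eq_sym.
Qed.

(** The result of [pick] depends only on the set of siblings, so all siblings get the same
    representative. *)
Definition sib_class x := odflt x [pick y | sib x y].

Lemma sib_class_sib x : sib x (sib_class x).
Proof.
rewrite /sib_class; case: pickP => [y //|/(_ x)].
by rewrite /sib eqxx.
Qed.

Lemma sib_classE x y : (sib_class x == sib_class y) = sib x y.
Proof.
apply/eqP/idP => [e|xy].
  by apply: sib_trans (sib_class_sib x) _; rewrite e sib_sym sib_class_sib.
have sxy : sib x =1 sib y.
  move=> z; apply/idP/idP; last exact: sib_trans.
  by apply: sib_trans; rewrite sib_sym.
rewrite /sib_class (eq_pick sxy); case: pickP => //= /(_ x).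
by rewrite sib_sym xy.
Qed.

Lemma rooting_exists : inhabited (rooting q v0).
Proof.
constructor; apply: (@Rooting _ _ _ dist parent sib_class).
- exact: dist_eq0.
- by move=> x /parentP [].
- by move=> x; apply/eqP; rewrite sib_classE sib_sym sib_class_sib.
- move=> x; apply/eqP/eqP => [e|->].
    by have := sib_class_sib x; rewrite e sib_sym sib_root => /eqP.
  by apply/eqP; rewrite -sib_root sib_class_sib.
- by move=> x y /eqP; rewrite sib_classE; apply: sib_parent.
- move=> x y; apply/idP/idP => [xy|/andP [xy]].
    rewrite (adj_neq xy) /= sib_classE /sib (negPf (adj_neq xy)) xy /=.
    have := dist_adj xy; have := xy; rewrite adj_sym => yx; have := dist_adj yx.
    case: (ltngtP (dist x) (dist y)) => //= d le1 le2.
      have e : dist y = (dist x).+1 by apply/eqP; rewrite eqn_leq le2 d.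
      have yv : y != v0 by rewrite -dist_eq0 e.
      by rewrite yv -(parent_unique yx e) eqxx orbT.
    have e : dist x = (dist y).+1 by apply/eqP; rewrite eqn_leq le1 d.
    have xv : x != v0 by rewrite -dist_eq0 e.
    by rewrite xv -(parent_unique xy e) eqxx.
  rewrite sib_classE /sib (negPf xy) /= => /or3P [/andP [] //||].
    by move=> /andP [/parentP [xp _] /eqP <-].
  by move=> /andP [/parentP [yp _] /eqP <-]; rewrite adj_sym.
- move=> x xv; have [xp dx] := parentP xv.
  (* The class of [x] consists of [x] and the [q.-1] common neighbors of [x] and its parent. *)
  have -> : [set y | sib_class y == sib_class x] =
            x |: common_neighbors x (parent x).
    apply/setP=> y; rewrite !inE sib_classE sib_sym /sib eq_sym.
    have [//|yx /=] := eqVneq y x; apply/andP/andP => [[xy /eqP e]|[xy py]].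
      have yv : y != v0 by rewrite -dist_eq0 -e dist_eq0.
      have [yp _] := parentP yv.
      by split=> //; rewrite (same_level_parent xy e) adj_sym.
    split=> //; have := dist_adj py; rewrite -dx => le1.
    have := dist_adj xy; have yx' := xy; rewrite adj_sym in yx'.
    have := dist_adj yx' => le2 _.
    have [//|neq] := eqVneq (dist x) (dist y).
    have e : dist x = (dist y).+1 by lia.
    by move: py; rewrite (parent_unique xy e) adj_irrefl.
  by rewrite cardsU1 !inE adj_irrefl (ct_common cG xp) /= add1n prednK.
Qed.

End RootingExists.

(** * The recursion for branch weights *)

Section BranchRecursion.
Local Open Scope ring_scope.
Variables (C : numFieldType) (q : nat).
Implicit Types (lam x y : C).

Definition branch_den lam x := (lam + 2) * (lam - q%:R - x) + 1.

Definition branch_map lam x := (x + q%:R) / branch_den lam x.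

Definition branch_seq lam k := iter k (branch_map lam) 0.

(** This keeps the denominators at all [branch_seq lam j] with [j <= k] positive, so that the
    recursion is monotone there. *)
Definition branch_valid lam k :=
  forall j, (j <= k)%N -> branch_seq lam j <= lam - q%:R.

Section FixedLambda.
Variable lam : C.
Hypotheses (q_gt0 : (0 < q)%N) (lam_ge0 : 0 <= lam).
Local Notation delta := (lam - q%:R).
Local Notation den := (branch_den lam).
Local Notation phi := (branch_map lam).
Local Notation rs := (branch_seq lam).
Local Notation valid := (branch_valid lam).

Let lam2_gt0 : 0 < lam + 2.
Proof. by rewrite ltr_wpDl. Qed.

Lemma branch_den_gt0 x : x <= delta -> 0 < den x.
Proof.
by move=> xd; rewrite ltr_wpDl // mulr_ge0 ?(ltW lam2_gt0) // subr_ge0.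
Qed.

Lemma branch_map_gt0 x : 0 <= x -> x <= delta -> 0 < phi x.
Proof.
by move=> x0 xd; rewrite divr_gt0 ?branch_den_gt0 // ltr_wpDl ?ltr0n.
Qed.

Lemma branch_map_sub x y : x <= delta -> y <= delta ->
  phi y - phi x = (y - x) * ((lam + 2) * lam + 1) / (den x * den y).
Proof.
move=> /branch_den_gt0 dx /branch_den_gt0 dy.
rewrite /branch_map; move: (lt0r_neq0 dx) (lt0r_neq0 dy); rewrite /branch_den.
by move=> nx ny; field; rewrite nx ny.
Qed.

Lemma branch_map_le x y : y <= delta -> x <= y -> phi x <= phi y.
Proof.
move=> yd xy; have xd := le_trans xy yd.
rewrite -subr_ge0 branch_map_sub // divr_ge0 //.
  by rewrite mulr_ge0 ?subr_ge0 // addr_ge0 ?mulr_ge0 // ltW.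
by rewrite mulr_ge0 // ltW // branch_den_gt0.
Qed.

Lemma branch_map_lt x y : y <= delta -> x < y -> phi x < phi y.
Proof.
move=> yd xy; have xd := le_trans (ltW xy) yd.
rewrite -subr_gt0 branch_map_sub // divr_gt0 //.
  by rewrite mulr_gt0 ?subr_gt0 // ltr_wpDl // mulr_ge0 // ltW.
by rewrite mulr_gt0 // branch_den_gt0.
Qed.

Lemma branch_map_shift x y : x <= delta -> y <= delta ->
  x + phi y - (phi x + y) = (lam + 2) * (x - y) * (delta - (x + phi y)) / den x.
Proof.
move=> /branch_den_gt0 dx /branch_den_gt0 dy.
rewrite /branch_map; move: (lt0r_neq0 dx) (lt0r_neq0 dy); rewrite /branch_den.
by move=> nx ny; field; rewrite nx ny.
Qed.

Lemma branch_seqS k : rs k.+1 = phi (rs k).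
Proof. by []. Qed.

Lemma branch_validW j k : (j <= k)%N -> valid k -> valid j.
Proof. by move=> jk vk i ij; apply: vk; apply: leq_trans ij jk. Qed.

Lemma branch_validS k : valid k -> rs k.+1 <= delta -> valid k.+1.
Proof. by move=> vk rk j; rewrite leq_eqVlt ltnS => /predU1P [->|/vk]. Qed.

Lemma branch_seq_ltS k : valid k -> rs k < rs k.+1 /\ 0 <= rs k.
Proof.
elim: k => [|k IH] vk.
  by split=> //; rewrite branch_map_gt0 //; apply: (vk 0%N).
have [lt ge0] := IH (branch_validW (leqnSn k) vk).
by split; [apply: branch_map_lt => //; apply: (vk k.+1) | apply: le_trans ge0 (ltW lt)].
Qed.

Lemma branch_seq_ge0 k : valid k -> 0 <= rs k.
Proof. by move=> /branch_seq_ltS []. Qed.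

Lemma branch_seq_lt i j : valid j -> (i < j)%N -> rs i < rs j.
Proof.
elim: j => // j IH vj; have vj' := branch_validW (leqnSn j) vj.
have [lt _] := branch_seq_ltS vj'.
by rewrite ltnS leq_eqVlt => /predU1P [->//|/(IH vj')] ij; apply: lt_trans lt.
Qed.

(* Moving one block from the shorter to the longer of two branches decreases  *)
(* the sum, by the identity [branch_map_shift].                               *)
Lemma branch_seq_subadditive a b : valid a -> valid b -> rs a + rs b <= delta ->
  [/\ valid (a + b), rs (a + b)%N <= rs a + rs b &
    rs a + rs b < delta -> rs (a + b)%N = rs a + rs b -> a = 0%N \/ b = 0%N].
Proof.
wlog ba : a b / (b <= a)%N => [hwlog|].
  case: (leqP b a) => [|/ltnW] ab va vb le; first exact: hwlog.
  have le2 : rs b + rs a <= delta by rewrite addrC.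
  have [] := hwlog b a ab vb va le2; rewrite (addrC (rs b)) (addnC b) => v l e.
  by split=> // lt /(e lt) [|]; [right|left].
elim: b a ba => [|b IH] a ba va vb le.
  by rewrite addn0 /= addr0; split=> //; right.
have vb' := branch_validW (leqnSn b) vb.
have rb0 := branch_seq_ge0 vb'; have ra0 := branch_seq_ge0 va.
have rad : rs a <= delta := va _ (leqnn _).
have lt_ba : rs b < rs a by apply: branch_seq_lt.
have shift := branch_map_shift rad (vb' _ (leqnn _)).
have step : rs a.+1 + rs b <= rs a + rs b.+1.
  rewrite -subr_ge0 [X in 0 <= X]shift divr_ge0 ?(ltW (branch_den_gt0 rad)) //.
  by rewrite !mulr_ge0 ?subr_ge0 ?(ltW lam2_gt0) ?(ltW lt_ba).
have le' := le_trans step le.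
have va' : valid a.+1.
  by apply: branch_validS => //; apply: le_trans le'; rewrite lerDl.
have [v l _] := IH a.+1 (leqW (ltnW ba)) va' vb' le'.
rewrite addSnnS in v l; split=> //; first exact: le_trans l step.
move=> lt e; suff lt' : rs a.+1 + rs b < rs a + rs b.+1.
  by have := le_lt_trans l lt'; rewrite e ltxx.
rewrite -subr_gt0 [X in 0 < X]shift divr_gt0 ?branch_den_gt0 //.
by rewrite !mulr_gt0 ?subr_gt0.
Qed.

(** Two-term subadditivity is iterated; partial sums stay below [delta] because the weights are
    nonnegative. *)
Lemma branch_seq_sum (s : seq nat) : (forall a, a \in s -> valid a) ->
  \sum_(a <- s) rs a <= delta ->
  [/\ valid (\sum_(a <- s) a)%N,
      rs (\sum_(a <- s) a)%N <= \sum_(a <- s) rs a &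
      \sum_(a <- s) rs a < delta ->
      rs (\sum_(a <- s) a)%N = \sum_(a <- s) rs a ->
      (count (fun a => 0 < a)%N s <= 1)%N].
Proof.
elim: s => [|a s IH] vs.
  by rewrite !big_nil => d0; split=> // j; rewrite leqn0 => /eqP ->.
rewrite !big_cons /= => le.
have va : valid a by apply: vs; apply: mem_head.
have vs' c : c \in s -> valid c by move=> cs; apply: vs; rewrite in_cons cs orbT.
have ra0 := branch_seq_ge0 va.
have les : \sum_(c <- s) rs c <= delta by apply: le_trans le; rewrite lerDr.
have [v l e] := IH vs' les.
set m := (\sum_(c <- s) c)%N in v l e *.
have le' : rs a + rs m <= rs a + \sum_(c <- s) rs c by rewrite lerD2l.
have [v2 l2 e2] := branch_seq_subadditive va v (le_trans le' le).
split=> //; first exact: le_trans l2 le'.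
(* Equality for the whole sum forces it for the tail and for the last merge; the latter makes [a] or
   the total of the tail zero. *)
move=> lt eq.
have em : rs m = \sum_(c <- s) rs c.
  by apply/le_anti; rewrite l /= -(lerD2l (rs a)) -eq.
have lts : \sum_(c <- s) rs c < delta by apply: le_lt_trans lt; rewrite lerDr.
have := e lts em.
rewrite -em in lt eq; case: (e2 lt eq) => [->//|m0 _].
suff -> : count (fun c => 0 < c)%N s = 0%N by case: (0 < a)%N.
have : (\sum_(c <- s) c)%N == 0%N by rewrite -/m m0.
elim: (s) => // c t IHt; rewrite big_cons addn_eq0 => /andP [/eqP -> /IHt].
by rewrite /= => ->.
Qed.

End FixedLambda.

(** When [lam] grows, the numerators shrink by induction and the denominators grow with
    [lam - q - x], while the validity bound becomes weaker. *)
Lemma branch_seq_anti lam mu k : (0 < q)%N -> 0 <= lam -> lam <= mu ->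
  branch_valid lam k ->
  0 <= branch_seq mu k <= branch_seq lam k /\ branch_valid mu k.
Proof.
move=> q0 l0 lm; have m0 := le_trans l0 lm.
have dd : lam - q%:R <= mu - q%:R by rewrite lerD2r.
elim: k => [|k IH] v.
  rewrite /= lexx; split=> // j; rewrite leqn0 => /eqP ->.
  exact: le_trans (v _ (leqnn _)) dd.
have vk := branch_validW (leqnSn k) v.
have [/andP [ge0 le] vm] := IH vk.
have led := vk _ (leqnn k); have lemd := vm _ (leqnn k).
have le1 : branch_seq mu k.+1 <= branch_seq lam k.+1.
  rewrite !branch_seqS /branch_map ler_pM //.
  - by rewrite addr_ge0.
  - by rewrite invr_ge0 ltW // branch_den_gt0.
  - by rewrite lerD2r.
  - rewrite lef_pV2 ?posrE ?branch_den_gt0 //.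
    rewrite lerD2r ler_pM //; first by rewrite addr_ge0.
    + by rewrite subr_ge0.
    + by rewrite lerD2r.
    + by rewrite lerB.
have ge1 : 0 <= branch_seq mu k.+1.
  by rewrite branch_seqS ltW // branch_map_gt0.
split; first by rewrite ge1.
apply: branch_validS => //; apply: le_trans le1 _.
exact: le_trans (v _ (leqnn _)) dd.
Qed.

End BranchRecursion.

(** * Walks of length two and the star bound *)

Section PerronVector.
Local Open Scope ring_scope.
Variables (C : numClosedFieldType) (G : sgraph).

Lemma rho_ge0 : 0 <= rho C G.
Proof. exact: bigmax_norm_ge0. Qed.

Lemma rho_real : rho C G \is Num.real.
Proof. exact: ger0_real rho_ge0. Qed.

(** A zero of the nonnegative eigenvector forces zeros at all neighbors, hence everywhere by
    connectedness. *)
Lemma perron_vector : connected G -> exists x : G -> C,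
  (forall u, 0 < x u) /\
  forall u, \sum_(v | adj u v) x v = rho C G * x u.
Proof.
move=> cG; have [x0 _] := connected_inhab cG.
have G_gt0 : (0 < #|G|)%N by apply/card_gt0P; exists x0.
pose A := adj_matrix C G.
have [||w [w_neq0 w_ge0 wA]] := symmetric_nonneg_eigenvector G_gt0 (A := A).
- by apply/matrixP=> i j; rewrite !mxE adj_sym.
- by move=> i j; rewrite mxE ler0n.
pose x u := w 0 (enum_rank u).
have x_ge0 u : 0 <= x u by apply: w_ge0.
have eig u : \sum_(v | adj u v) x v = rho C G * x u.
  have /rowP /(_ (enum_rank u)) := wA; rewrite !mxE => <-.
  rewrite (reindex (@enum_rank G)) /=; last exact: onW_bij (@enum_rank_bij G).
  rewrite big_mkcond; apply: eq_bigr => v _.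
  by rewrite mxE !enum_rankK adj_sym; case: ifP; rewrite ?mulr1 ?mulr0.
exists x; split=> // u; rewrite lt_neqAle x_ge0 andbT eq_sym.
apply: contraNneq w_neq0 => xu0; apply/eqP/rowP=> i; rewrite mxE.
rewrite -[i]enum_valK -/(x _); apply/eqP.
apply: (connect_invariant (P := [pred v | x v == 0])) _ (proj1 (connectedP u) cG u _) _.
  move=> a b ab /= /eqP xa0.
  have /eqP := eig a; rewrite xa0 mulr0 psumr_eq0 // => /allP /(_ b).
  by rewrite mem_index_enum ab => /(_ isT).
by rewrite /= xu0.
Qed.

End PerronVector.

Section WalkCount.
Variables (q : nat) (G : sgraph).
Hypothesis cG : clique_tree q G.

Definition neighbors (x : G) : {set G} := [set y | adj x y].

(** The vertices at distance at least three from [x]. *)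
Definition far (x : G) : {set G} :=
  [set y | [&& y != x, ~~ adj x y & common_neighbors x y == set0]].

(** Two common neighbors [a] and [b] give a four-cycle; [x] and [y] are joined off [a] through [b],
    so they would be adjacent. *)
Lemma common_neighbors_le1 (x y : G) : y != x -> ~~ adj x y ->
  #|common_neighbors x y| <= 1.
Proof.
move=> yx nxy; apply/card_le1_eqP=> a b.
rewrite !inE => /andP [xa ya] /andP [xb yb].
apply/eqP/negPn/negP => ab; case/negP: nxy.
have ax : adj a x by rewrite adj_sym.
have ay : adj a y by rewrite adj_sym.
apply: (ct_chord cG ax ay); first by rewrite eq_sym.
apply: (@connect_trans _ _ b); apply/connect1/and3P; split=> //.
- exact: adj_neq.
- by rewrite adj_sym.
- exact: adj_neq.
Qed.

(** Walks of length two from [x] are counted by their end: the degree for [x] itself, [q.-1] for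
    each neighbor, and one for each other vertex that is not far. *)
Lemma sum_degrees (x : G) :
  \sum_(y | adj x y) #|neighbors y| + #|far x| =
  q.-1 * #|neighbors x| + #|G|.-1.
Proof.
have -> : \sum_(y | adj x y) #|neighbors y| = \sum_z #|common_neighbors x z|.
  transitivity (\sum_(y | adj x y) \sum_(z | adj y z) 1).
    by apply: eq_bigr => y _; rewrite sum1dep_card.
  rewrite (exchange_big_dep predT) //=; apply: eq_bigr => z _.
  by rewrite sum1dep_card; apply: eq_card => y; rewrite !inE [adj z y]adj_sym.
rewrite (bigD1 x) //= (bigID (adj x)) /= -!addnA.
have -> : \sum_(z | (z != x) && adj x z) #|common_neighbors x z| =
    q.-1 * #|neighbors x|.
  rewrite (eq_bigl (fun z => z \in neighbors x)) => [|z]; last first.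
    by rewrite !inE; case xz: (adj x z); rewrite ?andbF // eq_sym adj_neq.
  rewrite (eq_bigr (fun=> q.-1)) => [|z]; last by rewrite inE => /(ct_common cG).
  by rewrite sum_nat_const mulnC.
have -> : \sum_(z | (z != x) && ~~ adj x z) #|common_neighbors x z| + #|far x| =
    #|[set z | (z != x) && ~~ adj x z]|.
  rewrite -sum1dep_card (bigID (fun z => common_neighbors x z == set0)) /=.
  rewrite [X in _ = X](bigID (fun z => common_neighbors x z == set0)) /=.
  rewrite big1 => [|z /andP [_ /eqP ->]]; last by rewrite cards0.
  rewrite add0n addnC; congr (_ + _).
    rewrite sum1dep_card; apply: eq_card => z; rewrite !inE -andbA; by [].
  apply: eq_bigr => z /andP [/andP [zx xz]]; rewrite -card_gt0 => c0.
  by apply/eqP; rewrite eqn_leq c0 andbT common_neighbors_le1.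
have -> : #|common_neighbors x x| = #|neighbors x|.
  by apply: eq_card => y; rewrite !inE andbb.
rewrite addnCA; congr (_ + _).
have -> : #|neighbors x| = #|[set z | (z != x) && adj x z]|.
  apply: eq_card => z; rewrite !inE.
  by case xz: (adj x z); rewrite ?andbF // eq_sym adj_neq.
rewrite -cardsUI.
have -> : [set z | (z != x) && adj x z] :&: [set z | (z != x) && ~~ adj x z] = set0.
  by apply/setP=> z; rewrite !inE; case: (adj x z); rewrite ?andbF.
rewrite cards0 addn0 -(cardsC1 x); apply: eq_card => z.
by rewrite !inE; case: (adj x z); rewrite !(andbT, andbF, orbF).
Qed.

End WalkCount.

Section StarBound.
Local Open Scope ring_scope.
Variables (C : numClosedFieldType) (q : nat).

(* The entries of A^2 - (q - 1) A are the degrees on the diagonal, 0 at pairs *)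
(* of adjacent vertices and the numbers of common neighbors elsewhere.        *)
Lemma perron_two_walks (G : sgraph) (x : G -> C) : clique_tree q G ->
  (forall u, \sum_(v | adj u v) x v = rho C G * x u) ->
  rho C G * (rho C G - q.-1%:R) * (\sum_u x u) + \sum_u #|far u|%:R * x u =
  #|G|.-1%:R * \sum_u x u.
Proof.
move=> cG eig.
have swap (y : G -> C) : \sum_u \sum_(v | adj u v) y v = \sum_v #|neighbors v|%:R * y v.
  rewrite (exchange_big_dep predT) //=; apply: eq_bigr => v _.
  rewrite sumr_const mulr_natl; congr (_ *+ _).
  by apply: eq_card => u; rewrite !inE adj_sym.
have walk1 : rho C G * \sum_u x u = \sum_v #|neighbors v|%:R * x v.
  by rewrite -swap big_distrr; apply: eq_bigr => u _.
have walk2 : rho C G * (rho C G * \sum_u x u) =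
    \sum_u (\sum_(v | adj u v) #|neighbors v|)%N%:R * x u.
  rewrite walk1 big_distrr /=.
  transitivity (\sum_u \sum_(v | adj u v) #|neighbors u|%:R * x v).
    apply: eq_bigr => u _; rewrite mulrCA -eig big_distrr /=.
    by apply: eq_bigr.
  rewrite (exchange_big_dep predT) //=; apply: eq_bigr => v _.
  rewrite natr_sum big_distrl /=; apply: eq_bigl => u.
  by rewrite adj_sym.
have count (u : G) : (\sum_(v | adj u v) #|neighbors v|)%N%:R =
    q.-1%:R * #|neighbors u|%:R + #|G|.-1%:R - #|far u|%:R :> C.
  by apply/(canRL (addrK _)); rewrite -natrD (sum_degrees cG) natrD natrM.
have -> : rho C G * (rho C G - q.-1%:R) * \sum_u x u =
    rho C G * (rho C G * \sum_u x u) - q.-1%:R * (rho C G * \sum_u x u) by ring.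
rewrite walk2 walk1 !big_distrr /= -sumrB -big_split; apply: eq_bigr => u _.
by rewrite count /=; ring.
Qed.

Lemma rho_no_far (G : sgraph) : clique_tree q G -> (forall u : G, far u = set0) ->
  rho C G * (rho C G - q.-1%:R) = #|G|.-1%:R.
Proof.
move=> cG far0; have [x [x_gt0 eig]] := perron_vector C (ct_connected cG).
have [x0 _] := connected_inhab (ct_connected cG).
have S_gt0 : 0 < \sum_u x u.
  by rewrite (bigD1 x0) //= ltr_wpDr // sumr_ge0 // => u _; apply: ltW.
have := perron_two_walks cG eig.
rewrite [X in _ + X]big1 ?addr0 => [|u _]; last by rewrite far0 cards0 mul0r.
by apply/mulIf/lt0r_neq0.
Qed.

(** In [perron_two_walks] the far terms are nonnegative, so [t = rho C G] satisfies
    [t * (t - (q - 1)) <= n - 1] with [n] the number of vertices, while [H] attains equality. If [G]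
    does too, positivity of [x] kills every far set. *)
Lemma rho_le_no_far (G H : sgraph) : clique_tree q G -> clique_tree q H ->
  #|G| = #|H| -> (1 < #|H|)%N -> (forall u : H, far u = set0) ->
  rho C G <= rho C H /\ (rho C G = rho C H -> forall u : G, far u = set0).
Proof.
move=> cG cH eGH H_gt1 far0; have rhoH := rho_no_far cH far0.
have [x [x_gt0 eig]] := perron_vector C (ct_connected cG).
have [x0 _] := connected_inhab (ct_connected cG).
have S_gt0 : 0 < \sum_u x u.
  by rewrite (bigD1 x0) //= ltr_wpDr // sumr_ge0 // => u _; apply: ltW.
have id := perron_two_walks cG eig.
have far_ge0 u : 0 <= #|far u|%:R * x u by rewrite mulr_ge0 ?ler0n ?ltW.
have le_n : rho C G * (rho C G - q.-1%:R) <= #|G|.-1%:R.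
  by rewrite -(ler_pM2r S_gt0) -id lerDl sumr_ge0.
split.
  case: (real_leP (rho_real C G) (rho_real C H)) => // lt.
  (* Both factors are positive at [rho C H], so the product increases strictly from there on. *)
  have n_gt0 : 0 < rho C H * (rho C H - q.-1%:R).
    by rewrite rhoH ltr0n -ltnS prednK // ltnW.
  have H_gt0 : 0 < rho C H.
    rewrite lt_neqAle rho_ge0 andbT eq_sym; apply: contraTneq n_gt0 => ->.
    by rewrite mul0r ltxx.
  rewrite pmulr_rgt0 // in n_gt0.
  have : rho C H * (rho C H - q.-1%:R) < rho C G * (rho C G - q.-1%:R).
    by apply: ltr_pM; rewrite ?ltrD2r // ltW.
  by rewrite rhoH -eGH => /lt_le_trans /(_ le_n); rewrite ltxx.
move=> eGH' u; rewrite eGH' rhoH -eGH in id.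
have /eqP : \sum_u #|far u|%:R * x u = 0.
  by apply: (addrI (#|G|.-1%:R * \sum_u x u)); rewrite id addr0.
rewrite psumr_eq0 // => /allP /(_ u); rewrite mem_index_enum => /(_ isT).
by rewrite /= mulf_eq0 (gt_eqF (x_gt0 u)) orbF pnatr_eq0 cards_eq0 => /eqP.
Qed.

End StarBound.

(** * Counting blocks and recognizing the star *)

Section RootingCount.
Variables (q : nat) (G : sgraph) (v0 : G).
Hypothesis q_gt0 : 0 < q.
Variable rt : rooting q v0.

(** One representative per block: a block is a class together with the common parent of its
    members. *)
Definition class_reps : {set G} := [set k | (k != v0) && (cls rt k == k)].

Lemma card_rooting : #|G| = (#|class_reps| * q).+1.
Proof.
have G_gt0 : 0 < #|G| by apply/card_gt0P; exists v0.
rewrite -(prednK G_gt0) -(cardsC1 v0); congr _.+1.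
transitivity (\sum_(x | x != v0) 1).
  by rewrite sum1dep_card; apply: eq_card => x; rewrite !inE.
rewrite (partition_big (cls rt) (mem class_reps)) /=; last first.
  by move=> x xv; rewrite inE cls_idem eqxx andbT cls_root.
rewrite -sum_nat_const; apply: eq_bigr => k; rewrite inE => /andP [kv /eqP ck].
apply: etrans (card_cls rt kv).
rewrite sum1dep_card; apply: eq_card => x; rewrite !inE ck.
by case: (cls rt x =P k) => e; rewrite ?andbT ?andbF // -(cls_root rt) e.
Qed.

End RootingCount.

Lemma clique_tree_card (q : nat) (G : sgraph) : 0 < q -> clique_tree q G ->
  #|G| = (((#|G| - 1) %/ q) * q).+1.
Proof.
move=> q_gt0 cG; have [v0 _] := connected_inhab (ct_connected cG).
have [rt] := rooting_exists v0 q_gt0 cG.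
by rewrite (card_rooting rt) subn1 /= mulnK.
Qed.

(** If [G] is not complete, a common neighbor [c] of two nonadjacent vertices [u] and [w] is the
    center: a vertex [y] not adjacent to [c] would connect [u] and [w] off [c] and so make them
    adjacent. *)
Lemma no_far_center (q : nat) (G : sgraph) : clique_tree q G ->
  (forall u : G, far u = set0) -> exists c : G, forall x, x != c -> adj c x.
Proof.
move=> cG far0.
have common (x y : G) : y != x -> ~~ adj x y -> exists z, adj x z && adj y z.
  move=> yx nxy; have /setP /(_ y) := far0 x; rewrite !inE yx nxy /=.
  by move/negbT/set0Pn => [z]; rewrite inE; exists z.
have [v _] := connected_inhab (ct_connected cG).
have [/existsP [u /existsP [w /andP [wu nuw]]]|complete_G] :=
    boolP [exists u : G, exists w : G, (w != u) && ~~ adj u w]; last first.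
  exists v => x xv; apply: contraNT complete_G => nvx.
  by apply/existsP; exists v; apply/existsP; exists x; rewrite xv.
have [c /andP [uc wc]] := common _ _ wu nuw; exists c => y yc.
apply/negPn/negP => ncy.
have [p /andP [cp yp]] := common _ _ yc ncy.
(* A neighbor of [c] reaches [y] directly or through a common neighbor, which is not [c] since [c]
   and [y] are not adjacent. *)
have reach z : adj z c -> connect (avoid c) z y.
  move=> zc; have zNc := adj_neq zc.
  have [->//|zy] := eqVneq z y.
  have [zy'|nzy] := boolP (adj z y); first by apply/connect1/and3P.
  rewrite eq_sym in zy; have [a /andP [za ya]] := common _ _ zy nzy.
  have ac : a != c by apply: contraNneq ncy => <-; rewrite adj_sym.
  apply: (@connect_trans _ _ a); apply/connect1/and3P; split=> //.
  by rewrite adj_sym.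
case/negP: nuw; apply: (ct_chord cG (w := c)); rewrite 1?adj_sym //.
  by rewrite eq_sym.
by apply: connect_trans (reach u uc) _; rewrite avoid_sym reach.
Qed.

Lemma iso_of_injective (G H : sgraph) (f : G -> H) : injective f ->
  #|H| <= #|G| -> (forall x y, adj (f x) (f y) = adj x y) -> iso G H.
Proof. by move=> f_inj le hom; exists f; split=> //; apply: inj_card_bij. Qed.

(** Rooted at [c], all other vertices have parent [c], so two of them are adjacent exactly when they
    share a class; the coordinates are the index of the class and the rank in it. *)
Lemma center_iso_star (q b : nat) (G : sgraph) (c : G) : 0 < q -> 0 < b ->
  clique_tree q G -> #|G| = (b * q).+1 -> (forall x, x != c -> adj c x) ->
  iso G (star_block q b).
Proof.
move=> q_gt0 b_gt0 cG cardG adj_c.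
have [rt] := rooting_exists c q_gt0 cG.
have card_reps : #|class_reps rt| = b.
  move: (card_rooting rt); rewrite cardG => -[] /eqP.
  by rewrite eqn_pmul2r // => /eqP ->.
have adjE x y : x != c -> y != c -> adj x y = (x != y) && (cls rt x == cls rt y).
  move=> xc yc; rewrite (rooting_adj rt) xc yc /=; congr (_ && _).
  have par_c z : z != c -> par rt z = c.
    move=> zc; move: (adj_c z zc); rewrite (rooting_adj rt) eqxx zc /=.
    rewrite [cls rt c == _]eq_sym => /andP [_ /orP [/eqP e|/eqP //]].
    by move: (cls_root rt c); rewrite -e cls_root eqxx (negPf zc).
  by rewrite !par_c // ![c == _]eq_sym (negPf xc) (negPf yc) !orbF.
pose members x := enum [set y | cls rt y == cls rt x].
(* For [x != c] the indices are in range, so the default values of [insubd] are not reached. *)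
pose class_of x : 'I_b :=
  insubd (Ordinal b_gt0) (index (cls rt x) (enum (class_reps rt))).
pose rank_of x : 'I_q := insubd (Ordinal q_gt0) (index x (members x)).
have rep x : x != c -> cls rt x \in enum (class_reps rt).
  by move=> xc; rewrite mem_enum inE cls_idem cls_root xc eqxx.
have class_ofE x : x != c ->
    class_of x = index (cls rt x) (enum (class_reps rt)) :> nat.
  by move=> xc; rewrite val_insubd -{1}card_reps cardE index_mem rep.
have mem_members x : x \in members x by rewrite mem_enum inE.
have rank_ofE x : x != c -> rank_of x = index x (members x) :> nat.
  move=> xc; rewrite val_insubd -[X in (_ < X)%N](card_cls rt xc) cardE.
  by rewrite index_mem mem_members.
have class_eq x y : x != c -> y != c ->
    (class_of x == class_of y) = (cls rt x == cls rt y).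
  move=> xc yc; apply/eqP/eqP => [/(congr1 val) /=|e].
    by rewrite !class_ofE // => /(index_inj c); apply; apply: rep.
  by apply/val_inj; rewrite /= !class_ofE // e.
pose f x : star_block q b := if x == c then None else Some (class_of x, rank_of x).
apply: (@iso_of_injective _ _ f).
- move=> x y; rewrite /f.
  have [->|xc] := eqVneq x c; have [->|yc] := eqVneq y c => //.
  case=> /eqP; rewrite class_eq // => /eqP e /(congr1 val) /=.
  rewrite !rank_ofE // /members e => /(index_inj c).
  by apply; rewrite mem_enum inE ?e.
- by rewrite cardG (card_star q b).
- move=> x y; rewrite /f {1}/adj /= /star_adj.
  have [->|xc] := eqVneq x c; have [->|yc] := eqVneq y c.
  + by rewrite adj_irrefl.
  + by rewrite adj_c.
  + by rewrite adj_sym adj_c.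
  + rewrite adjE // class_eq //.
    case: (cls rt x =P cls rt y) => e; rewrite ?andbF // !andbT.
    have [->|xy] := eqVneq x y; first by rewrite eqxx.
    apply/negP => /eqP [_ /(congr1 val)] /=.
    rewrite !rank_ofE // /members e => /(index_inj c) e'.
    by case/eqP: xy; apply: e'; rewrite mem_enum inE ?e.
Qed.

Lemma star_no_far (q b : nat) (u : star_block q b) : far u = set0.
Proof.
apply/setP=> v; rewrite !inE; apply/negbTE.
apply/and3P => -[vu nuv /set0Pn []].
have [uN|uN] := eqVneq u None.
  by case/negP: nuv; rewrite uN star_center_adj // -uN.
have [vN|vN] := eqVneq v None.
  by case/negP: nuv; rewrite adj_sym vN star_center_adj.
by exists None; rewrite inE; apply/andP; split; rewrite adj_sym star_center_adj.
Qed.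

(** * Branch weights in a Perron vector *)

Section RootedTree.
Variables (q : nat) (G : sgraph) (v0 : G).
Variable rt : rooting q v0.
Local Notation lev := (lvl rt).
Local Notation p := (par rt).
Local Notation cl := (cls rt).

Definition child w c := (c != v0) && (p c == w).

Lemma lvl_child w c : child w c -> lev c = (lev w).+1.
Proof. by case/andP=> cv /eqP <-; apply: lvl_par. Qed.

Lemma child_par c : c != v0 -> child (p c) c.
Proof. by rewrite /child eqxx andbT. Qed.

Lemma lvl_gt0 w : (0 < lev w) = (w != v0).
Proof. by rewrite lt0n lvl_eq0. Qed.

Lemma cls_neq_root x y : cl x = cl y -> x != v0 -> y != v0.
Proof. by move=> e; rewrite -(cls_root rt x) e cls_root. Qed.

Lemma cls_lvl x y : cl x = cl y -> lev x = lev y.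
Proof.
move=> e; have [xv|xv] := eqVneq x v0.
  have : y == v0 by rewrite -(cls_root rt) -e cls_root xv.
  by rewrite xv => /eqP ->.
have yv := cls_neq_root e xv.
by rewrite (lvl_par rt xv) (lvl_par rt yv) (cls_par e).
Qed.

Lemma child_cls w x y : cl x = cl y -> child w x -> child w y.
Proof.
by move=> e /andP [xv px]; rewrite /child (cls_neq_root e xv) -(cls_par e).
Qed.

Definition child_rep w k := child w k && (cl k == k).

Lemma child_rep_cls w c : child w c -> child_rep w (cl c).
Proof.
by move=> wc; rewrite /child_rep cls_idem eqxx andbT (child_cls _ wc) ?cls_idem.
Qed.

Lemma sum_children (R : Type) (idx : R) (op : Monoid.com_law idx) w (f : G -> R) :
  \big[op/idx]_(c | child w c) f c =
  \big[op/idx]_(k | child_rep w k) \big[op/idx]_(y | cl y == cl k) f y.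
Proof.
rewrite (partition_big cl (child_rep w)) => [|c]; last exact: child_rep_cls.
apply: eq_bigr => k /andP [wk /eqP ck]; rewrite ck; apply: eq_bigl => y.
case: (cl y =P k) => [e|]; rewrite ?andbT ?andbF //.
by apply: (child_cls _ wk); rewrite ck e.
Qed.

Definition height := (\max_w lev w).+1.

Lemma lvl_height w : lev w < height.
Proof. by rewrite ltnS; apply: leq_bigmax. Qed.

Lemma rooted_ind (P : G -> Prop) :
  (forall w, (forall c, child w c -> P c) -> P w) -> forall w, P w.
Proof.
move=> step w; have [m] := ubnP (height - lev w).
elim: m w => // m IH w lt; apply: step => c /lvl_child e; apply: IH.
by rewrite e; have := lvl_height w; move: lt; lia.
Qed.

(** [m] is fuel, and [height - lev w] is enough of it; each block is counted once, at the
    representative of its class. *)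
Fixpoint below m w :=
  if m is m'.+1 then \sum_(c | child w c) ((cl c == c) + below m' c) else 0.

Definition blocks_below w := below (height - lev w) w.
Local Notation N := blocks_below.

Lemma blocks_below_children w : N w = \sum_(c | child w c) ((cl c == c) + N c).
Proof.
rewrite /N -subnSK ?lvl_height //=; apply: eq_bigr => c /lvl_child ->.
by [].
Qed.

Lemma sum_reps k : \sum_(y | cl y == cl k) (cl y == y) = 1.
Proof.
rewrite (bigD1 (cl k)) ?cls_idem ?eqxx //= big1 // => y /andP [/eqP e yk].
by rewrite e eq_sym (negPf yk).
Qed.

Lemma blocks_below_classes w :
  N w = \sum_(k | child_rep w k) (\sum_(y | cl y == cl k) N y).+1.
Proof.
rewrite blocks_below_children sum_children; apply: eq_bigr => k _.
by rewrite big_split /= sum_reps.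
Qed.

Lemma blocks_below_eq0 w : N w = 0 -> forall c, ~~ child w c.
Proof.
move=> N0 c; apply/negP => /child_rep_cls wk; move/eqP: N0.
by rewrite blocks_below_classes sum_nat_eq0 => /forall_inP /(_ _ wk).
Qed.

Lemma blocks_below_childless w : (forall c, ~~ child w c) -> N w = 0.
Proof.
by move=> no; rewrite blocks_below_children big_pred0 // => c; apply/negbTE.
Qed.

(** Downward induction on the level: each vertex of level [j.+1] is a child of exactly one vertex of
    level [j]. *)
Lemma sum_blocks_below j :
  \sum_(w | lev w == j) N w = \sum_(k | j < lev k) (cl k == k).
Proof.
have [m] := ubnP (height - j); elim: m j => // m IH j lt.
have [le|gt] := leqP height j.
  rewrite !big_pred0 // => w; apply/negbTE.
    by rewrite -leqNgt; apply: leq_trans le; apply/ltnW/lvl_height.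
  by rewrite neq_ltn (leq_trans (lvl_height w) le).
have lt' : height - j.+1 < m by move: lt gt; lia.
transitivity (\sum_(c | lev c == j.+1) ((cl c == c) + N c)).
  rewrite [RHS](partition_big p (fun w => lev w == j)) => [|c /eqP e]; last first.
    by rewrite -eqSS -(lvl_par rt) ?e // -lvl_gt0 e.
  apply: eq_bigr => w /eqP e; rewrite blocks_below_children.
  apply: eq_bigl => c; rewrite /child -lvl_gt0.
  case: (p c =P w) => [pc|]; rewrite ?andbF ?andbT //.
  apply/idP/eqP => [|-> //]; rewrite lvl_gt0 => cv.
  by rewrite (lvl_par rt cv) pc e.
rewrite big_split /= IH // [RHS](bigID (fun k => lev k == j.+1)) /=.
congr (_ + _); apply: eq_bigl => k.
  by apply/eqP/andP => [->|[_ /eqP]].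
by rewrite ltn_neqAle [_ == lev k]eq_sym andbC.
Qed.

Lemma blocks_below_root : N v0 = #|class_reps rt|.
Proof.
transitivity (\sum_(w | lev w == 0) N w).
  by rewrite (big_pred1 v0) // => w; rewrite lvl_eq0.
rewrite sum_blocks_below -sum1_card; rewrite [LHS]big_mkcond [RHS]big_mkcond.
apply: eq_bigr => k _; rewrite !inE lvl_gt0.
by case: (k != v0) => //=; case: (cl k == k).
Qed.

End RootedTree.

Section RootedPerron.
Local Open Scope ring_scope.
Variables (C : numClosedFieldType) (q : nat) (G : sgraph) (v0 : G).
Hypothesis q_gt0 : (0 < q)%N.
Variable rt : rooting q v0.
Variables (lam : C) (x : G -> C).
Hypotheses (lam_ge0 : 0 <= lam) (x_gt0 : forall u, 0 < x u).
Hypothesis eig : forall u, \sum_(v | adj u v) x v = lam * x u.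
Local Notation p := (par rt).
Local Notation cl := (cls rt).
Local Notation N := (blocks_below rt).
Local Notation child := (child rt).
Local Notation child_rep := (child_rep rt).
Local Notation delta := (lam - q%:R).
Local Notation rs := (branch_seq q lam).
Local Notation valid := (branch_valid q lam).

Definition class_sum c := \sum_(y | cl y == cl c) x y.

Definition block_sum c := x (p c) + class_sum c.

(* A branch at [w] enters the eigenvalue equation of the block of [w] and     *)
(* [p w] only through this number.                                            *)
Definition branch_weight w := (lam + 1) * x w / block_sum w - 1.
Local Notation r := branch_weight.

Let x_ge0 u : 0 <= x u. Proof. exact/ltW/x_gt0. Qed.

Let lam1_gt0 : 0 < lam + 1.
Proof. by rewrite ltr_wpDl. Qed.

Lemma class_sum_ge c : x c <= class_sum c.
Proof. by rewrite /class_sum (bigD1 c) //= lerDl sumr_ge0. Qed.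

Lemma class_sum_gt0 c : 0 < class_sum c.
Proof. exact: lt_le_trans (x_gt0 c) (class_sum_ge c). Qed.

Lemma block_sum_gt0 c : 0 < block_sum c.
Proof. by rewrite addr_gt0 ?class_sum_gt0. Qed.

Lemma block_sum_cls c d : cl c = cl d -> block_sum c = block_sum d.
Proof. by move=> e; rewrite /block_sum /class_sum e (cls_par e). Qed.

(** Adding [x w] to the neighbor sum gives the closed neighborhood, which splits into the block of
    [w] with its parent and the children of [w]. *)
Lemma eig_nonroot w : w != v0 ->
  (lam + 1) * x w = block_sum w + \sum_(c | child w c) x c.
Proof.
move=> wv; rewrite mulrDl mul1r -eig.
have -> : \sum_(v | adj w v) x v + x w = \sum_(v | adj w v || (v == w)) x v.
  rewrite [RHS](bigD1 w) ?eqxx ?orbT //= addrC; congr (_ + _).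
  apply: eq_bigl => v; case: eqVneq => [->|_]; first by rewrite adj_irrefl.
  by rewrite orbF andbT.
rewrite (bigID (fun v => cl v == cl w)) /= /block_sum addrAC addrC.
have pw_lvl : lvl rt w = (lvl rt (p w)).+1 by apply: lvl_par.
have pw_cl : cl (p w) != cl w.
  by apply/eqP => /cls_lvl e; move: pw_lvl; rewrite e; lia.
congr (_ + _).
  rewrite [LHS](bigD1 (p w)) /=; last first.
    rewrite pw_cl andbT (rooting_adj rt) wv eqxx /= orbT andbT.
    by rewrite (_ : w != p w) //; apply: contraNneq pw_cl => <-.
  congr (_ + _); apply: eq_bigl => v; rewrite /child (rooting_adj rt) wv /=.
  have [->|vp] := eqVneq v (p w).
    rewrite andbF; apply/esym/negbTE; apply/negP => /lvl_child e.
    by move: pw_lvl; rewrite e; lia.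
  rewrite /= andbT.
  have [->|vw] := eqVneq v w.
    rewrite eqxx andbF; apply/esym/negbTE; apply/negP => e.
    by have := lvl_child (e : child w w); lia.
  rewrite orbF /= eq_sym; case: (cl v =P cl w) => //= e.
    apply/esym/negbTE; apply/negP => e'.
    by have := lvl_child (e' : child w v); rewrite (cls_lvl e); lia.
  by rewrite andbT.
apply: eq_bigl => v; rewrite (rooting_adj rt); case: (cl v =P cl w) => // e.
  by rewrite e eqxx /= andbT eq_sym; case: eqP.
by rewrite andbF.
Qed.

Lemma eig_root : lam * x v0 = \sum_(c | child v0 c) x c.
Proof.
rewrite -eig; apply: eq_bigl => v; rewrite (rooting_adj rt) eqxx /= /child.
have [//|vv] := eqVneq v v0.
rewrite /=; case: (cl v0 =P cl v) => // /esym/(cls_neq_root) /(_ vv).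
by rewrite eqxx.
Qed.

Lemma branch_weightE w : w != v0 ->
  r w = (\sum_(c | child w c) x c) / block_sum w.
Proof.
move=> wv; rewrite /branch_weight eig_nonroot // mulrDl divff ?lt0r_neq0 ?block_sum_gt0 //.
by rewrite addrC addKr.
Qed.

Lemma branch_weight_ge0 w : w != v0 -> 0 <= r w.
Proof.
move=> wv; rewrite branch_weightE // divr_ge0 ?sumr_ge0 //.
exact/ltW/block_sum_gt0.
Qed.

Lemma class_weight c : c != v0 ->
  \sum_(y | cl y == cl c) r y = (lam + 1) * class_sum c / block_sum c - q%:R.
Proof.
move=> cv; rewrite sumrB; congr (_ - _).
  rewrite mulrAC /class_sum big_distrr /=; apply: eq_bigr => y /eqP e.
  by rewrite (block_sum_cls e) mulrAC.
rewrite sumr_const; congr (_%:R); apply: etrans (card_cls rt cv).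
by apply: eq_card => y; rewrite !inE.
Qed.

(** The slack below [delta] vanishes exactly when the class carries the whole neighbor sum of its
    parent, as at a root lying in one block. *)
Lemma class_weight_gap c : c != v0 ->
  delta - \sum_(y | cl y == cl c) r y =
  (lam * x (p c) - class_sum c) / block_sum c.
Proof.
move=> cv; rewrite class_weight //; have := lt0r_neq0 (block_sum_gt0 c).
by rewrite /block_sum => nz; field.
Qed.

Lemma class_sum_children w k : child_rep w k ->
  class_sum k <= \sum_(c | child w c) x c.
Proof.
move=> wk; rewrite sum_children (bigD1 k) //= lerDl sumr_ge0 // => d _.
exact/ltW/class_sum_gt0.
Qed.

Lemma class_sum_cls c : class_sum (cl c) = class_sum c.
Proof. by rewrite /class_sum cls_idem. Qed.

(** The class is part of the neighborhood of its parent; a nonroot parent has its own parent as a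
    further neighbor, which makes the bound strict. *)
Lemma class_sum_le c : c != v0 -> class_sum c <= lam * x (p c) /\
  (p c != v0 -> class_sum c < lam * x (p c)).
Proof.
move=> cv; have := class_sum_children (child_rep_cls (child_par rt cv)).
rewrite class_sum_cls => le.
have [pv|pv] := eqVneq (p c) v0.
  by rewrite pv in le *; rewrite eig_root.
have lt : class_sum c < lam * x (p c).
  have := eig_nonroot pv; rewrite mulrDl mul1r => /(canRL (addrK _)) ->.
  rewrite addrAC; apply: le_lt_trans le _; rewrite ltrDr subr_gt0.
  by apply: le_lt_trans (class_sum_ge _) _; rewrite ltrDr.
by split=> [|_ //]; apply: ltW.
Qed.

Lemma class_weight_le c : c != v0 -> \sum_(y | cl y == cl c) r y <= delta.
Proof.
move=> cv; rewrite -subr_ge0 class_weight_gap // divr_ge0 ?(ltW (block_sum_gt0 _)) //.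
by rewrite subr_ge0; have [] := class_sum_le cv.
Qed.

Lemma class_weight_lt c : c != v0 -> p c != v0 ->
  \sum_(y | cl y == cl c) r y < delta.
Proof.
move=> cv pv; rewrite -subr_gt0 class_weight_gap // divr_gt0 ?block_sum_gt0 //.
by rewrite subr_gt0; have [_] := class_sum_le cv; apply.
Qed.

Lemma branch_weight_le w : w != v0 -> r w <= delta.
Proof.
move=> wv; apply: le_trans (class_weight_le wv).
rewrite (bigD1 w) //= lerDl sumr_ge0 // => y /andP [/eqP e _].
exact: branch_weight_ge0 (cls_neq_root (esym e) wv).
Qed.

Lemma class_sum_lt1 c : c != v0 -> 0 < (lam + 1) * x (p c) - class_sum c.
Proof.
move=> cv; rewrite subr_gt0 mulrDl mul1r.
by apply: le_lt_trans (proj1 (class_sum_le cv)) _; rewrite ltrDl.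
Qed.

(** The right-hand side is the weight that a nonroot [p c] would have if this block were the only
    one below it and the values of [x] on the block were kept. *)
Lemma branch_map_class c : c != v0 ->
  branch_map q lam (\sum_(y | cl y == cl c) r y) =
  class_sum c / ((lam + 1) * x (p c) - class_sum c).
Proof.
move=> cv; rewrite class_weight // /branch_map /branch_den.
have n1 := lt0r_neq0 (block_sum_gt0 c); have n2 := lt0r_neq0 (class_sum_lt1 cv).
have n3 := lt0r_neq0 lam1_gt0; rewrite /block_sum in n1 *.
set s := class_sum c in n1 n2 *; set y := x (p c) in n1 n2 *.
have -> : (lam + 2) * (lam - q%:R - ((lam + 1) * s / (y + s) - q%:R)) + 1 =
          (lam + 1) * ((lam + 1) * y - s) / (y + s) by field.
by field; rewrite n1 n2 n3.
Qed.

(** Induction invariant: a branch weighs at least as much as a path-block with the same number of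
    blocks. *)
Definition weight_bound w := valid (N w) /\ rs (N w) <= r w.

Definition branches_below c := (\sum_(y | cl y == cl c) N y)%N.

(** The path weights within the class merge by [branch_seq_sum]. Its equality case needs a sum
    strictly below [delta], which a nonroot parent provides. *)
Lemma class_bound c : c != v0 ->
  (forall y, cl y = cl c -> weight_bound y) ->
  [/\ valid (branches_below c),
      rs (branches_below c) <= \sum_(y | cl y == cl c) r y &
      p c != v0 -> rs (branches_below c) = \sum_(y | cl y == cl c) r y ->
      (forall y, cl y = cl c -> rs (N y) = r y) /\
      (forall y z, cl y = cl c -> cl z = cl c -> y != z -> N y = 0%N \/ N z = 0%N)].
Proof.
move=> cv IH; pose A := [pred y | cl y == cl c].
have le_sum : \sum_(y | cl y == cl c) rs (N y) <= \sum_(y | cl y == cl c) r y.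
  by apply: ler_sum => y /eqP /IH [].
pose s := [seq N y | y <- enum A].
have sumN : (\sum_(a <- s) a)%N = branches_below c by rewrite big_map big_enum.
have sumR : \sum_(a <- s) rs a = \sum_(y | cl y == cl c) rs (N y).
  by rewrite big_map big_enum.
have vs a : a \in s -> valid a.
  by case/mapP=> y; rewrite mem_enum => /eqP /IH [v _] ->.
have les : \sum_(a <- s) rs a <= delta.
  by rewrite sumR; apply: le_trans le_sum (class_weight_le cv).
have [v l e] := branch_seq_sum q_gt0 lam_ge0 vs les.
rewrite sumN sumR in v l e; split=> //; first exact: le_trans l le_sum.
move=> pv eq.
have eq_sum : \sum_(y | cl y == cl c) rs (N y) = \sum_(y | cl y == cl c) r y.
  by apply/le_anti; rewrite le_sum -eq l.
split=> [y yc|y z yc zc yz].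
  have /eqP : \sum_(y | cl y == cl c) (r y - rs (N y)) = 0.
    by rewrite sumrB eq_sum subrr.
  rewrite psumr_eq0 => [|z /eqP /IH [_ le]]; last by rewrite subr_ge0.
  move=> /allP /(_ y); rewrite mem_index_enum yc eqxx subr_eq0 => /(_ isT).
  by move/eqP.
have le1 : (count (fun a => 0 < a)%N s <= 1)%N.
  by apply: e; [rewrite eq_sum class_weight_lt | rewrite eq_sum].
have [|Ny] := posnP (N y); first by left.
have [|Nz] := posnP (N z); first by right.
(* Two distinct members with blocks below them would give two positive entries of [s]. *)
have uA : uniq (filter (preim (blocks_below rt) (fun a => 0 < a)%N) (enum A)).
  by rewrite filter_uniq // enum_uniq.
exfalso; move: le1; apply/negP.
rewrite -ltnNge count_map -size_filter -(card_uniqP uA).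
apply: (@leq_trans #|[set y; z]|); first by rewrite cards2 yz.
apply: subset_leq_card; apply/subsetP=> u; rewrite !inE mem_filter /= mem_enum.
by case/orP=> /eqP ->; rewrite ?Ny ?Nz /= inE ?yc ?zc.
Qed.

(** Each block below [w] gets a path bound by monotonicity of [branch_map], and these bounds merge
    by [branch_seq_sum]. Equality at [w] turns every inequality used into an equality. *)
Lemma vertex_bound w : w != v0 -> (forall c, child w c -> weight_bound c) ->
  weight_bound w /\ (rs (N w) = r w ->
   [/\ forall c, child w c -> rs (N c) = r c,
       forall c d, child w c -> child w d -> cl c = cl d &
       forall c d, child w c -> cl c = cl d -> c != d -> N c = 0%N \/ N d = 0%N]).
Proof.
move=> wv IH.
have child_v c : child w c -> c != v0 by case/andP.
have child_p c : child w c -> p c = w by case/andP => _ /eqP.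
have cb k : child_rep w k -> [/\ valid (branches_below k),
      rs (branches_below k) <= \sum_(y | cl y == cl k) r y &
      p k != v0 -> rs (branches_below k) = \sum_(y | cl y == cl k) r y ->
      (forall y, cl y = cl k -> rs (N y) = r y) /\
      (forall y z, cl y = cl k -> cl z = cl k -> y != z -> N y = 0%N \/ N z = 0%N)].
  case/andP=> wk _; apply: class_bound; first exact: child_v wk.
  by move=> y yk; apply/IH/(child_cls (esym yk) wk).
pose W := block_sum w.
have W_gt0 : 0 < W := block_sum_gt0 w.
have W_eq : W = (lam + 1) * x w - \sum_(c | child w c) x c.
  by rewrite eig_nonroot // addrK.
have rE : r w = \sum_(k | child_rep w k) class_sum k / W.
  by rewrite branch_weightE // sum_children -big_distrl.
pose a k := class_sum k / ((lam + 1) * x w - class_sum k).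
have aE k : child_rep w k -> branch_map q lam (\sum_(y | cl y == cl k) r y) = a k.
  by case/andP=> wk _; rewrite branch_map_class ?child_v // child_p.
(* Superadditivity: the actual denominator [W] subtracts all classes below [w], the denominator of
   [a k] only one of them. *)
have W_le k : child_rep w k -> W <= (lam + 1) * x w - class_sum k.
  by move=> wk; rewrite W_eq lerD2l lerN2 class_sum_children.
have a_le k : child_rep w k -> a k <= class_sum k / W.
  move=> wk; rewrite ler_pM2l ?class_sum_gt0 // lef_pV2 ?posrE ?W_le //.
  exact: lt_le_trans W_gt0 (W_le k wk).
have n_le k : child_rep w k -> rs (branches_below k).+1 <= a k.
  move=> wk; have [v l _] := cb k wk; rewrite -aE // branch_seqS.
  by apply: branch_map_le => //; apply: class_weight_le; apply: child_v; case/andP: wk.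
have term_le k : child_rep w k -> class_sum k / W <= delta.
  move=> wk; apply: le_trans (branch_weight_le wv); rewrite rE (bigD1 k) //=.
  by rewrite lerDl sumr_ge0 // => i _; rewrite divr_ge0 ?ltW // class_sum_gt0.
have n_valid k : child_rep w k -> valid (branches_below k).+1.
  move=> wk; have [v _ _] := cb k wk; apply: branch_validS => //.
  exact: le_trans (n_le k wk) (le_trans (a_le k wk) (term_le k wk)).
pose s := [seq (branches_below k).+1 | k <- enum (child_rep w)].
have sumN : (\sum_(m <- s) m)%N = N w.
  by rewrite big_map big_enum /= blocks_below_classes.
have sumR : \sum_(m <- s) rs m = \sum_(k | child_rep w k) rs (branches_below k).+1.
  by rewrite big_map big_enum.
have le_sum : \sum_(m <- s) rs m <= r w.
  rewrite sumR rE; apply: ler_sum => k wk.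
  exact: le_trans (n_le k wk) (a_le k wk).
have vs m : m \in s -> valid m.
  by case/mapP=> k; rewrite mem_enum => wk ->; apply: n_valid.
have [v l _] := branch_seq_sum q_gt0 lam_ge0 vs (le_trans le_sum (branch_weight_le wv)).
rewrite sumN in v l; split; first by split=> //; apply: le_trans l le_sum.
move=> eq.
have eq_sum : \sum_(m <- s) rs m = r w by apply/le_anti; rewrite le_sum -eq l.
(* A vanishing sum of nonnegative differences gives equality in every term. *)
have eq_term k : child_rep w k ->
    rs (branches_below k).+1 = a k /\ a k = class_sum k / W.
  move=> wk.
  have /eqP : \sum_(k | child_rep w k) (class_sum k / W - rs (branches_below k).+1) = 0.
    by rewrite sumrB -rE -sumR eq_sum subrr.
  rewrite psumr_eq0 => [|i wi]; last first.
    by rewrite subr_ge0; apply: le_trans (n_le i wi) (a_le i wi).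
  move=> /allP /(_ k); rewrite mem_index_enum wk subr_eq0 => /(_ isT) /eqP e.
  have e' : a k = class_sum k / W by apply/le_anti; rewrite a_le // e n_le.
  by rewrite e'.
have eq_class k : child_rep w k ->
    (forall y, cl y = cl k -> rs (N y) = r y) /\
    (forall y z, cl y = cl k -> cl z = cl k -> y != z -> N y = 0%N \/ N z = 0%N).
  move=> wk; have [vk lk ek] := cb k wk; apply: ek.
    by case/andP: wk => /child_p ->.
  (* Strict monotonicity of [branch_map] carries the equality back to the weight of the class. *)
  apply/eqP; rewrite eq_le lk /=; apply/negPn/negP => nle.
  have lt : rs (branches_below k) < \sum_(y | cl y == cl k) r y.
    by rewrite lt_neqAle lk andbT; apply: contraNneq nle => ->.
  have kv : k != v0 by apply: child_v; case/andP: wk.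
  have := branch_map_lt lam_ge0 (class_weight_le kv) lt.
  by rewrite aE // -branch_seqS (proj1 (eq_term k wk)) ltxx.
split.
- move=> c wc; have [ec _] := eq_class _ (child_rep_cls wc).
  by apply: ec; rewrite cls_idem.
(* A second class below [w] would make [W] strictly smaller than the denominator of [a k]. *)
- have uniq_rep k k' : child_rep w k -> child_rep w k' -> k = k'.
    move=> wk wk'; apply/eqP/negPn/negP => kk'.
    have [_ ] := eq_term k wk; apply/eqP; rewrite lt_eqF //.
    rewrite ltr_pM2l ?class_sum_gt0 // ltf_pV2 ?posrE //; last first.
      exact: lt_le_trans W_gt0 (W_le k wk).
    rewrite W_eq ltrD2l ltrN2 sum_children (bigD1 k) //= ltrDl.
    rewrite (bigD1 k') /=; last by rewrite wk' eq_sym.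
    apply: ltr_wpDr; last exact: class_sum_gt0.
    by apply: sumr_ge0 => i _; apply/ltW/class_sum_gt0.
  by move=> c d wc wd; apply: uniq_rep; apply: child_rep_cls.
- move=> c d wc cd; have [_ ec] := eq_class _ (child_rep_cls wc).
  by apply: ec; rewrite cls_idem.
Qed.

Lemma weight_bound_all w : w != v0 -> weight_bound w.
Proof.
elim/(rooted_ind (rt := rt)): w => w IH wv.
have [] // := vertex_bound wv.
by move=> c wc; apply: IH => //; case/andP: wc.
Qed.

End RootedPerron.

(** * The lower bound, rooted in a leaf block *)

(** [v] lies in a single block, and that block meets other blocks at most in [p]. *)
Definition end_vertex (G : sgraph) (v p : G) : Prop :=
  [/\ adj v p,
      forall a b, adj v a -> adj v b -> a != b -> adj a b &
      forall a y, adj v a -> a != p -> adj a y -> y = v \/ adj v y].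

(** A deepest vertex of any rooting works, with its parent as [p]: no member of its class has a
    child. *)
Lemma end_vertex_exists (q : nat) (G : sgraph) : 0 < q -> clique_tree q G ->
  1 < #|G| -> exists v p : G, end_vertex v p.
Proof.
move=> q_gt0 cG G_gt1; have [r0 _] := connected_inhab (ct_connected cG).
have [rt] := rooting_exists r0 q_gt0 cG.
pose v := [arg max_(u > r0) lvl rt u].
have maxv u : lvl rt u <= lvl rt v by rewrite /v; case: arg_maxnP => // w _; apply.
have vr : v != r0.
  have /card_gt0P [u] : 0 < #|[set~ r0]| by rewrite cardsC1; lia.
  by rewrite !inE -!(lvl_gt0 rt) => /leq_trans; apply.
have no_child a y : lvl rt a = lvl rt v -> y != r0 -> par rt y <> a.
  by move=> la yr e; have := maxv y; rewrite (lvl_par rt yr) e la ltnn.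
have nbr a : adj v a -> cls rt a = cls rt v \/ a = par rt v.
  rewrite (rooting_adj rt) vr /= => /andP [_].
  case/or3P => [/eqP ->|/eqP ->|]; [by left|by right|].
  by case/andP=> ar /eqP /(no_child v a erefl ar).
have adj_par a : cls rt a = cls rt v -> adj (par rt v) a.
  move=> e; have ar := cls_neq_root (esym e) vr.
  have neq : par rt v != a.
    rewrite -(cls_par e); apply/eqP => e'.
    by have := lvl_par rt ar; rewrite e'; lia.
  by rewrite (rooting_adj rt) neq ar (cls_par e) eqxx !orbT.
have adj_cls a b : cls rt a = cls rt b -> a != b -> adj a b.
  by move=> e ab; rewrite (rooting_adj rt) ab e eqxx.
exists v, (par rt v); split.
- by rewrite adj_sym adj_par.
- move=> a b /nbr [ea|->] /nbr [eb|->] ab.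
  + by apply: adj_cls => //; rewrite ea.
  + by rewrite adj_sym adj_par.
  + exact: adj_par.
  + by rewrite eqxx in ab.
- move=> a y /nbr [ea|->] ap ay; last by rewrite eqxx in ap.
  have ar := cls_neq_root (esym ea) vr.
  have [->|yv] := eqVneq y v; first by left.
  right; move: ay; rewrite (rooting_adj rt) ar /= => /andP [_ /or3P [/eqP e|/eqP <-|]].
  + by apply: adj_cls; [rewrite -ea | rewrite eq_sym].
  + by rewrite (cls_par ea) adj_sym adj_par.
  + by case/andP=> yr /eqP /(no_child a y (cls_lvl ea) yr).
Qed.

Section LowerBound.
Local Open Scope ring_scope.
Variables (C : numClosedFieldType) (q b : nat) (G : sgraph).
Hypotheses (q_gt0 : (0 < q)%N) (b_gt0 : (0 < b)%N).
Hypotheses (cG : clique_tree q G) (cardG : #|G| = (b * q).+1).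
Local Notation lam := (rho C G).

(** Rooted at an end vertex [v0], only [p0] in the root block has children, so all other [b.-1]
    blocks hang at [p0], and the weight of [p0] is exactly [delta]. *)
Lemma branch_seq_bound : exists (v0 : G) (rt : rooting q v0),
  [/\ branch_valid q lam b.-1, branch_seq q lam b.-1 <= lam - q%:R &
      branch_seq q lam b.-1 = lam - q%:R ->
      forall x y, lvl rt x = lvl rt y -> cls rt x = cls rt y].
Proof.
have G_gt1 : (1 < #|G|)%N by rewrite cardG ltnS muln_gt0 b_gt0.
have [v0 [p0 [vp simp others]]] := end_vertex_exists q_gt0 cG G_gt1.
have [rt] := rooting_exists v0 q_gt0 cG.
have [x [x_gt0 eig]] := perron_vector C (ct_connected cG).
have lam_ge0 := rho_ge0 C G.
have childE c : child rt v0 c = adj v0 c.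
  rewrite /child (rooting_adj rt) eqxx /= [v0 == c]eq_sym.
  have [//|cv] := eqVneq c v0; rewrite /=.
  case: (cls rt v0 =P cls rt c) => // /esym/(cls_neq_root) /(_ cv).
  by rewrite eqxx.
have vp' : child rt v0 p0 by rewrite childE.
have /andP [p0v /eqP par_p0] := vp'.
have one_class c : child rt v0 c -> cls rt c = cls rt p0.
  move=> vc; have [->//|cp] := eqVneq c p0.
  have /andP [cv /eqP pc] := vc.
  have : adj c p0 by apply: simp; rewrite -?childE.
  rewrite (rooting_adj rt) pc par_p0 => /andP [_ /or3P [/eqP //||]].
    by rewrite [v0 == p0]eq_sym (negPf p0v) andbF.
  by rewrite [v0 == c]eq_sym (negPf cv) andbF.
have childless c d : child rt v0 c -> c != p0 -> ~~ child rt c d.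
  move=> vc cp; apply/negP => /andP [dv /eqP pd].
  have /andP [cv _] := vc.
  have cd : adj c d.
    have neq : c != d.
      by rewrite -pd; apply/eqP => e; have := lvl_par rt dv; rewrite e; lia.
    by rewrite (rooting_adj rt) neq pd eqxx dv !orbT.
  rewrite childE in vc; have [e|] := others _ _ vc cp cd.
    by rewrite e eqxx in dv.
  by rewrite -childE => /andP [_ /eqP]; rewrite pd => e; rewrite e eqxx in cv.
have class_child y : cls rt y = cls rt p0 -> child rt v0 y.
  by move=> e; apply: (child_cls (esym e)).
have reps : child_rep rt v0 =1 pred1 (cls rt p0).
  move=> k /=; apply/idP/eqP => [/andP [vk /eqP <-]|->]; first exact: one_class.
  exact: child_rep_cls.
pose N := blocks_below rt.
have N0 y : cls rt y = cls rt p0 -> y != p0 -> N y = 0%N.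
  move=> e yp; apply: blocks_below_childless => d.
  by apply: childless => //; apply: class_child.
have Np0 : N p0 = b.-1.
  have : N v0 = b.
    rewrite /N blocks_below_root; move: (card_rooting rt); rewrite cardG.
    by move=> [] /eqP; rewrite eqn_pmul2r // => /eqP.
  rewrite /N blocks_below_classes (big_pred1 (cls rt p0)) // cls_idem.
  rewrite (bigD1 p0) //= big1 => [|y /andP [/eqP e yp]]; last exact: N0.
  by rewrite addn0 => <-.
pose r := branch_weight rt (rho C G) x.
have r0 y : y != v0 -> (forall d, ~~ child rt y d) -> r y = 0.
  move=> yv no; rewrite /r branch_weightE // big_pred0 ?mul0r // => d.
  exact/negbTE.
(* The root lies in one block, so its eigenvalue equation closes the gap in [class_weight_gap]; all
   members other than [p0] have weight zero. *)
have rp0 : r p0 = lam - q%:R.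
  have sum_r : \sum_(y | cls rt y == cls rt p0) r y = r p0.
    rewrite (bigD1 p0) //= big1 ?addr0 // => y /andP [/eqP e yp].
    apply: r0; first exact: cls_neq_root (esym e) p0v.
    by move=> d; apply: childless => //; apply: class_child.
  have := class_weight_gap rt lam x_gt0 p0v; rewrite sum_r.
  rewrite par_p0 (eig_root rt eig) sum_children (big_pred1 (cls rt p0)) //.
  rewrite cls_idem -/(class_sum rt x p0) subrr mul0r.
  by move/eqP; rewrite subr_eq0 => /eqP ->.
have [v l] := weight_bound_all q_gt0 rt lam_ge0 x_gt0 eig p0v.
rewrite -/N Np0 -/r rp0 in v l.
exists v0, rt; split=> // eq.
have bound w : w != v0 ->
    branch_seq q lam (N w) = r w ->
   [/\ forall c, child rt w c -> branch_seq q lam (N c) = r c,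
       forall c d, child rt w c -> child rt w d -> cls rt c = cls rt d &
       forall c d, child rt w c -> cls rt c = cls rt d -> c != d ->
         N c = 0%N \/ N d = 0%N].
  move=> wv; apply: (proj2 (vertex_bound q_gt0 lam_ge0 x_gt0 eig wv _)).
  by move=> c /andP [cv _]; apply: weight_bound_all.
(* Equality holds at [p0] and passes from each vertex to its children; the other vertices of the
   root block have weight zero and no blocks below. *)
have tight w : w != v0 -> branch_seq q lam (N w) = r w.
  have [m] := ubnP (lvl rt w); elim: m w => // m IH w lt wv.
  have [pv|pv] := eqVneq (par rt w) v0.
    have vw : child rt v0 w by rewrite /child wv pv eqxx.
    have [->|wp] := eqVneq w p0; first by rewrite Np0 rp0.
    have ew := one_class _ vw.
    by rewrite (N0 _ ew wp) r0 // => d; apply: childless.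
  have lt' : (lvl rt (par rt w) < m)%N by rewrite -ltnS -(lvl_par rt wv).
  have [+ _ _] := bound _ pv (IH _ lt' pv).
  by apply; rewrite /child wv eqxx.
suff main l' : forall y z, lvl rt y = l' -> lvl rt z = l' -> cls rt y = cls rt z.
  by move=> y z e; apply: (main (lvl rt z)).
elim: l' => [y z /eqP + /eqP|l' IH y z ly lz].
  by rewrite !lvl_eq0 => /eqP -> /eqP ->.
have yv : y != v0 by rewrite -(lvl_gt0 rt) ly.
have zv : z != v0 by rewrite -(lvl_gt0 rt) lz.
have lpy : lvl rt (par rt y) = l' by move: ly; rewrite (lvl_par rt yv) => -[].
have lpz : lvl rt (par rt z) = l' by move: lz; rewrite (lvl_par rt zv) => -[].
have cy := child_par rt yv.
have cz := child_par rt zv.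
have [pyv|pyv] := eqVneq (par rt y) v0.
  have pzv : par rt z = v0.
    by apply/eqP; rewrite -(lvl_eq0 rt) lpz -lpy lvl_eq0 pyv.
  by rewrite pyv in cy; rewrite pzv in cz; rewrite !one_class.
have pzv : par rt z != v0 by rewrite -(lvl_gt0 rt) lpz -lpy lvl_gt0.
(* Tightness at the common parent puts [y] and [z] in one class. Distinct parents would be two
   members of one class with blocks below, which tightness at the grandparent excludes, or the
   choice of [p0] if that is the root. *)
suff eqp : par rt y = par rt z.
  have [_ + _] := bound _ pyv (tight _ pyv).
  by apply=> //; rewrite eqp.
have epc := IH _ _ lpy lpz.
apply/eqP/negPn/negP => neq.
pose g := par rt (par rt y).
have cg : child rt g (par rt y) := child_par rt pyv.
have [gv|gv] := eqVneq g v0.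
  have only_p0 u d : child rt v0 u -> child rt u d -> u = p0.
    move=> vu ud; apply/eqP/negPn/negP => up.
    by have /negP := childless _ d vu up.
  rewrite gv in cg; have cg' := child_cls epc cg.
  by case/eqP: neq; rewrite (only_p0 _ _ cg cy) (only_p0 _ _ cg' cz).
have [_ _ +] := bound _ gv (tight _ gv).
move=> /(_ _ _ cg epc neq) [] /blocks_below_eq0.
  by move=> /(_ y); rewrite cy.
by move=> /(_ z); rewrite cz.
Qed.

End LowerBound.

(** * The path-block *)

Section PathRadius.
Local Open Scope ring_scope.
Variables (C : numClosedFieldType) (q b : nat).
Hypotheses (q_gt0 : (0 < q)%N) (b_gt0 : (0 < b)%N).
Local Notation P := (path_block q b).
Local Notation mu := (rho C P).
Local Notation B k := (@interval_block q b k).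

(** With [Z k] the sum of the eigenvector over block [k] and [X j] its entry at [j * q], the
    eigenvalue equations become a recursion, solved from the last block back to the first. *)
Lemma path_branch_seq : branch_seq q mu b.-1 = mu - q%:R.
Proof.
have [y [y_gt0 eig]] := perron_vector C (path_connected b q_gt0).
have mu_ge0 := rho_ge0 C P.
have mu1_gt0 : 0 < mu + 1 by rewrite ltr_wpDl.
pose Z k := \sum_(v in B k) y v.
pose X j := y (inord (j * q)).
(* Adding [y u] once for each block containing [u] completes the neighbor sum to full block sums. *)
have key u : (mu + #|[set k : 'I_b | u \in B k]|%:R) * y u =
    \sum_(k < b | u \in B k) Z k.
  rewrite mulrDl -eig.
  have -> : #|[set k : 'I_b | u \in B k]|%:R * y u = \sum_(k < b | u \in B k) y u.
    rewrite sumr_const mulr_natl; congr (_ *+ _).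
    by apply: eq_card => k; rewrite [LHS]inE.
  transitivity (\sum_(k < b | u \in B k) (\sum_(v in B k | v != u) y v + y u)); last first.
    by apply: eq_bigr => k uk; rewrite /Z [RHS](bigD1 u) //= addrC.
  rewrite big_split /=; congr (_ + _).
  rewrite (exchange_big_dep (fun v => adj u v)) /=; last first.
    by move=> k v uk /andP [vk vu]; apply: (path_adjI (ltn_ord k)); rewrite // eq_sym.
  apply: eq_bigr => v uv; have [k [kb uk vk uNv]] := path_adjP uv.
  rewrite (big_pred1 (Ordinal kb)) // => l /=.
  apply/idP/eqP => [/and3P [ul vl _]|->]; last by rewrite uk vk eq_sym.
  by apply/val_inj/esym; apply: (interval_block_eq q_gt0 uNv).
have inordE j : (j <= b)%N -> (inord (j * q) : P) = (j * q)%N :> nat.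
  by move=> jb; rewrite inordK // ltnS leq_mul2r jb orbT.
have in_block j k : (j <= b)%N -> ((inord (j * q) : P) \in B k) = (k <= j <= k.+1)%N.
  by move=> jb; rewrite inE inordE // !leq_pmul2r.
have one_block u k : (k < b)%N -> u \in B k ->
    (forall l, (l < b)%N -> u \in B l -> l = k) -> (mu + 1) * y u = Z k.
  move=> kb uk only; have := key u.
  have pred_k (l : 'I_b) : (u \in B l) = (l == Ordinal kb).
    by apply/idP/eqP => [ul|-> //]; apply/val_inj/(only _ (ltn_ord l) ul).
  have -> : #|[set l : 'I_b | u \in B l]| = 1%N.
    rewrite -(cards1 (Ordinal kb)); apply: eq_card => l.
    by rewrite [LHS]inE in_set1 pred_k.
  by rewrite (big_pred1 _ pred_k).
have X0 : (mu + 1) * X 0%N = Z 0%N.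
  apply: one_block => //; first by rewrite in_block.
  by move=> l lb; rewrite in_block //; lia.
have Xb : (mu + 1) * X b = Z b.-1.
  apply: one_block; first by rewrite prednK.
    by rewrite in_block // prednK // leq_pred leqnn.
  by move=> l lb; rewrite in_block //; lia.
have Xj j : (0 < j)%N -> (j < b)%N -> (mu + 2) * X j = Z j.-1 + Z j.
  move=> j0 jb; have jb' : (j.-1 < b)%N by rewrite (leq_ltn_trans (leq_pred _)).
  have := key (inord (j * q)).
  have preds (l : 'I_b) : ((inord (j * q) : P) \in B l) =
      (l == Ordinal jb') || (l == Ordinal jb).
    by rewrite in_block ?(ltnW jb) // -!val_eqE /=; lia.
  rewrite (bigD1 (Ordinal jb')) /=; last first.
    by rewrite in_block ?(ltnW jb) //; lia.
  have neq : Ordinal jb != Ordinal jb' by rewrite -val_eqE /=; lia.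
  rewrite (big_pred1 (Ordinal jb)) => [|l]; last first.
    rewrite preds /=; have [->|] := eqVneq l (Ordinal jb'); last by rewrite andbT.
    by rewrite eq_sym (negPf neq).
  move=> <- /=; congr ((_ + _%:R) * _).
  transitivity #|[set Ordinal jb; Ordinal jb']|; first by rewrite cards2 neq.
  by apply: eq_card => l; rewrite in_set preds in_set2 orbC.
have Zk k : (k < b)%N -> (mu + 1) * (X k + X k.+1) = (mu + 2 - q%:R) * Z k.
  move=> kb; have kb' := ltnW kb.
  pose u0 : P := inord (k * q); pose u1 : P := inord (k.+1 * q).
  have u01 : u1 != u0.
    by rewrite -val_eqE /= !inordE // eqn_pmul2r //; lia.
  have u0k : u0 \in B k by rewrite in_block // leqnn leqnSn.
  have u1k : u1 \in B k by rewrite in_block // leqnn leqnSn.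
  (* The [q.-1] vertices other than the two ends lie in this block only, and each contributes
     [Z k]. *)
  have e : (mu + 1) * Z k = (mu + 1) * (X k + X k.+1) + q.-1%:R * Z k.
    rewrite {1}/Z (bigD1 u0) //= (bigD1 u1) /=; last by rewrite u1k.
    rewrite addrA mulrDr; congr (_ + _).
    rewrite big_distrr /=.
    rewrite (eq_bigr (fun=> Z k)) => [|v /andP [/andP [vk v0] v1]]; last first.
      apply: (one_block _ _ kb vk) => l lb vl.
      case: (ltngtP l k) => // lk.
        have [ek ev] := interval_block_lt q_gt0 vl vk lk.
        by case/eqP: v0; apply/val_inj; rewrite /= inordE // ev ek.
      have [el ev] := interval_block_lt q_gt0 vk vl lk.
      by case/eqP: v1; apply/val_inj; rewrite /= inordE // ev.
    rewrite sumr_const mulr_natl; congr (_ *+ _).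
    have := card_interval_block q_gt0 kb.
    rewrite (cardsD1 u0) u0k (cardsD1 u1) in_setD1 u01 u1k !add1n.
    move=> [/(congr1 predn) /= cq].
    apply: etrans cq; apply: eq_card => v; rewrite !in_setD1.
    by rewrite andbA andbC [(v != u1) && _]andbC andbA.
  apply: (addIr (q.-1%:R * Z k)); rewrite -e.
  have -> : q.-1%:R = q%:R - 1 :> C by rewrite -subn1 natrB.
  by ring.
have y0 u := lt0r_neq0 (y_gt0 u).
have Z_gt0 k : (k < b)%N -> 0 < Z k.
  move=> kb; rewrite /Z (bigD1 (inord (k * q))) /=; last first.
    by rewrite in_block ?leqnn ?leqnSn // ltnW.
  by rewrite ltr_wpDr // sumr_ge0 // => v _; apply/ltW/y_gt0.
(* After [i] blocks counted from the far end, the ratio of [(mu + 1) * X] to [Z] is one plus the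
   weight of a path branch with [i] blocks. *)
have main i : (i < b)%N ->
    (mu + 1) * X (b - i)%N = (1 + branch_seq q mu i) * Z (b - i).-1.
  elim: i => [|i IH] ib; first by rewrite subn0 /= addr0 mul1r.
  have {IH} := IH (ltnW ib); set t := branch_seq q mu i.
  rewrite branch_seqS -/t; have -> : (b - i = (b - i.+1).+1)%N by lia.
  have j0 : (0 < b - i.+1)%N by lia.
  have jb : (b - i.+1 < b)%N by lia.
  move: (b - i.+1)%N j0 jb => j j0 jb /= eX1.
  have eX : (mu + 1) * X j = (mu - q%:R + 1 - t) * Z j.
    have := Zk j jb; rewrite mulrDr eX1 => /(canRL (addrK _)) ->; by ring.
  have eZ : (mu + 1) * Z j.-1 = branch_den q mu t * Z j.
    have -> : Z j.-1 = (mu + 2) * X j - Z j by rewrite Xj // addrK.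
    rewrite mulrBr mulrCA eX /branch_den; by ring.
  have jb' : (j.-1 < b)%N by lia.
  have den0 : branch_den q mu t != 0.
    apply: contraTneq (mulr_gt0 mu1_gt0 (Z_gt0 _ jb')) => d0.
    by rewrite eZ d0 mul0r ltxx.
  apply: (mulfI (lt0r_neq0 mu1_gt0)); rewrite eX [RHS]mulrCA eZ /branch_map.
  rewrite mulrA mulrA; congr (_ * _).
  rewrite [RHS]mulrDl mul1r divfK // /branch_den.
  by ring.
have lt : (b.-1 < b)%N by rewrite prednK.
(* At the first block the end equation [X0] closes the recursion and fixes the last weight. *)
have := main _ lt; have -> : (b - b.-1 = 1)%N by lia.
move=> /= e1; have := Zk 0%N b_gt0; rewrite mulrDr e1 X0.
move=> e2; have e3 : 1 + (1 + branch_seq q mu b.-1) = mu + 2 - q%:R.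
  by apply: (mulIf (lt0r_neq0 (Z_gt0 _ b_gt0))); rewrite -e2 [LHS]mulrDl mul1r.
have -> : branch_seq q mu b.-1 = 1 + (1 + branch_seq q mu b.-1) - 2 by ring.
by rewrite e3; ring.
Qed.

End PathRadius.

(** * Reconstructing the path-block when each level is a single class *)

Section LinearRooting.
Variables (q b : nat) (G : sgraph) (v0 : G) (rt : rooting q v0).
Hypotheses (q_gt0 : 0 < q) (b_gt0 : 0 < b) (cardG : #|G| = (b * q).+1).
Hypothesis linear : forall x y, lvl rt x = lvl rt y -> cls rt x = cls rt y.
Local Notation lev := (lvl rt).
Local Notation cl := (cls rt).
Local Notation p := (par rt).

(** [x] and its ancestors supply a class representative on each positive level up to [lev x], and
    there are [b] representatives in all. *)
Lemma linear_lvl_le x : lev x <= b.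
Proof.
pose S y := [set k in class_reps rt | lev k <= lev y].
have reps : #|class_reps rt| = b.
  move: (card_rooting rt); rewrite cardG => -[] /eqP.
  by rewrite eqn_pmul2r // => /eqP ->.
suff le : lev x <= #|S x|.
  apply: leq_trans le _; rewrite -reps; apply: subset_leq_card.
  by apply/subsetP=> k; rewrite inE => /andP [].
have [m] := ubnP (lev x); elim: m x => // m IH x lt.
have [->|xv] := eqVneq x v0; first by rewrite (eqP (_ : lev v0 == 0)) // lvl_eq0.
have e := lvl_par rt xv; rewrite e.
have le : lev (p x) <= #|S (p x)| by apply: IH; rewrite -ltnS -e.
have clS : cl x \notin S (p x).
  by rewrite !inE (cls_lvl (cls_idem rt x)) e ltnn andbF.
have := subset_leq_card (_ : cl x |: S (p x) \subset S x).
rewrite cardsU1 clS add1n => H; apply: leq_ltn_trans le (H _).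
apply/subsetP=> k; rewrite !inE => /predU1P [->|/andP [-> le']].
  by rewrite cls_root xv cls_idem eqxx (cls_lvl (cls_idem rt x)) leqnn.
by rewrite e; apply: leqW.
Qed.

Definition has_child x := [exists c, child rt x c].

(* The vertex continuing to the next level, if any, comes last in its class.  *)
Definition level_seq x :=
  [seq y <- enum [set y | cl y == cl x] | ~~ has_child y] ++
  [seq y <- enum [set y | cl y == cl x] | has_child y].

Definition position x := index x (level_seq x).

Lemma mem_level_seq x y : cl x = cl y -> x \in level_seq y.
Proof.
move=> e; have : x \in enum [set z | cl z == cl y] by rewrite mem_enum inE e.
rewrite /level_seq; move: (enum _) => s xs.
by rewrite mem_cat !mem_filter xs; case: has_child.
Qed.

Lemma size_level_seq x : x != v0 -> size (level_seq x) = q.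
Proof.
move=> xv; rewrite size_cat !size_filter addnC count_predC -cardE.
exact: card_cls.
Qed.

Lemma position_lt x : x != v0 -> position x < q.
Proof.
move=> xv; rewrite -[X in _ < X](size_level_seq xv) index_mem.
exact: mem_level_seq.
Qed.

Lemma position_inj x y : lev x = lev y -> position x = position y -> x = y.
Proof.
move=> /linear e; rewrite /position /level_seq e -/(level_seq y).
by apply: (@index_inj _ v0); apply: mem_level_seq.
Qed.

(** Two members with children would have them on one level, hence in one class with one parent; so
    the continuing vertex is unique and comes last. *)
Lemma position_has_child x : x != v0 -> has_child x -> position x = q.-1.
Proof.
move=> xv hx.
have others : [seq y <- enum [set y | cl y == cl x] | has_child y] = [:: x].
  rewrite (@eq_in_filter _ _ (pred1 x)) => [|y].
    by rewrite filter_pred1_uniq ?enum_uniq // mem_enum inE.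
  rewrite mem_enum inE => /eqP yx /=; apply/idP/eqP => [hy|->//].
  have /existsP [c xc] := hx; have /existsP [d yd] := hy.
  have /andP [_ /eqP <-] := xc; have /andP [_ /eqP <-] := yd.
  by apply/cls_par/linear; rewrite (lvl_child xc) (lvl_child yd) (cls_lvl yx).
have := size_level_seq xv.
rewrite /position /level_seq size_cat others addn1 => /(congr1 predn) sz.
by apply: etrans sz; rewrite index_cat mem_filter hx /= eqxx addn0.
Qed.

(** Level [l > 0] fills the integers from [l.-1 * q + 1] to [l * q]; the last position, that of a
    continuing vertex, goes to the shared vertex [l * q]. *)
Definition path_index x := if x == v0 then 0 else ((lev x).-1 * q + position x).+1.

Lemma path_index_lt x : path_index x < (b * q).+1.
Proof.
rewrite /path_index; have [//|xv] := eqVneq x v0.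
have lx : 0 < lev x by rewrite lvl_gt0.
have := position_lt xv; have : (lev x).-1.+1 * q <= b * q.
  by rewrite prednK // leq_mul2r linear_lvl_le orbT.
by rewrite mulSn; lia.
Qed.

Definition to_path x : path_block q b := Ordinal (path_index_lt x).

(** The vertices placed at [lev x * q], the starting point of the next interval. *)
Definition tail x := (x == v0) || (position x == q.-1).

Lemma to_path_block x k : (to_path x \in interval_block q b k) =
  (k.+1 == lev x) || ((k == lev x) && tail x).
Proof.
rewrite inE /= /path_index /tail; have [->|xv] := eqVneq x v0.
  have -> : lev v0 = 0 by apply/eqP; rewrite lvl_eq0.
  by rewrite leqn0 muln_eq0 (gtn_eqF q_gt0) orbF andbT.
have : 0 < lev x by rewrite lvl_gt0.
case: (lev x) => // l _ /=; have lt := position_lt xv.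
rewrite eqSS; apply/andP/orP => [[le1 le2]|[/eqP ->|/andP [/eqP -> /eqP ->]]].
- case: (ltngtP k l) => [kl|kl|->]; last by left.
    have : k.+1 * q <= l * q by rewrite leq_mul2r kl orbT.
    by move: le2; lia.
  right; have : l.+1 * q <= k * q by rewrite leq_mul2r kl orbT.
  rewrite mulSn => le3; have pos : position x = q.-1 by lia.
  rewrite pos eqxx andbT eqn_leq kl andbT leqNgt; apply/negP => lk.
  have : l.+2 * q <= k * q by rewrite leq_mul2r lk orbT.
  by rewrite !mulSn; lia.
- by rewrite mulSn; lia.
- by rewrite !mulSn; lia.
Qed.

Lemma to_path_inj : injective to_path.
Proof.
move=> x y /(congr1 val) /=; rewrite /path_index.
have [->|xv] := eqVneq x v0; have [->|yv] := eqVneq y v0 => // -[e].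
have lx := position_lt xv; have ly := position_lt yv.
have el : (lev x).-1 = (lev y).-1.
  have := congr1 (fun m => m %/ q) e.
  by rewrite !divnMDl // !divn_small // !addn0.
apply: position_inj; last by move: e; rewrite el => /addnI.
have : 0 < lev x by rewrite lvl_gt0.
have : 0 < lev y by rewrite lvl_gt0.
by lia.
Qed.

Lemma tail_unique x y : lev x = lev y -> tail x -> tail y -> x = y.
Proof.
rewrite /tail.
have [->|xv] := eqVneq x v0; have [->|yv] := eqVneq y v0 => //= e.
- by move: yv; rewrite -(lvl_eq0 rt) -e lvl_eq0 eqxx.
- by move: xv; rewrite -(lvl_eq0 rt) e lvl_eq0 eqxx.
- by move=> /eqP px /eqP py; apply: position_inj; rewrite // px py.
Qed.

(** Interval [k] receives level [k.+1] and the tail of level [k], which is the parent of all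
    vertices of level [k.+1]. *)
Lemma to_path_adj x y : adj (to_path x) (to_path y) = adj x y.
Proof.
have tail_par z : z != v0 -> tail (p z).
  move=> zv; rewrite /tail; have [//|pv] := eqVneq (p z) v0 => /=.
  apply/eqP/position_has_child => //; apply/existsP; exists z.
  exact: child_par.
have to_par z w k : lev z = k.+1 -> lev w = k -> tail w -> z != v0 /\ p z = w.
  move=> ez ew tw; have zv : z != v0 by rewrite -(lvl_gt0 rt) ez.
  split=> //; apply: tail_unique => //; last exact: tail_par.
  by move: ez; rewrite (lvl_par rt zv) ew => -[].
rewrite path_adjE (inj_eq to_path_inj) (rooting_adj rt).
have [//|xy /=] := eqVneq x y.
apply/idP/or3P => [/existsP [k]|H].
  rewrite !to_path_block => /andP [/orP [/eqP ex|/andP [/eqP ex tx]]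
                                   /orP [/eqP ey|/andP [/eqP ey ty]]].
  - by apply: Or31; apply/eqP/linear; rewrite -ex.
  - by apply: Or32; have [-> ->] := to_par x y k (esym ex) (esym ey) ty; rewrite eqxx.
  - by apply: Or33; have [-> ->] := to_par y x k (esym ey) (esym ex) tx; rewrite eqxx.
  - by case/eqP: xy; apply: tail_unique => //; rewrite -ex.
have common z w k : k < b ->
    (to_path z \in interval_block q b k) && (to_path w \in interval_block q b k) ->
    [exists k' : 'I_b, (to_path z \in interval_block q b k') &&
                       (to_path w \in interval_block q b k')].
  by move=> kb zw; apply/existsP; exists (Ordinal kb).
have lev_pred z : z != v0 -> (lev z).-1.+1 = lev z /\ (lev z).-1 < b.
  by rewrite -(lvl_gt0 rt) => lz; rewrite prednK //; split=> //; apply: linear_lvl_le.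
have par_case z : z != v0 -> (lev z).-1 = lev (p z) by move=> /(lvl_par rt) ->.
case: H => [/eqP e|/andP [xv /eqP <-]|/andP [yv /eqP <-]].
- have xv : x != v0.
    apply: contraNneq xy => xv.
    by rewrite xv eq_sym -(cls_root rt y) -e xv cls_root.
  have [e1 lt] := lev_pred x xv; apply: (common _ _ _ lt).
  by rewrite !to_path_block e1 (cls_lvl e) eqxx.
- have [e1 lt] := lev_pred x xv; apply: (common _ _ _ lt).
  by rewrite !to_path_block e1 par_case // !eqxx tail_par // orbT.
- have [e1 lt] := lev_pred y yv; apply: (common _ _ _ lt).
  by rewrite !to_path_block e1 par_case // !eqxx tail_par // orbT.
Qed.

Lemma linear_iso_path : iso G (path_block q b).
Proof.
apply: (iso_of_injective to_path_inj); last exact: to_path_adj.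
by rewrite card_ord cardG.
Qed.

End LinearRooting.

(** Write [lam] and [mu] for the two radii and [r] for [branch_seq] at [b.-1]. From [lam <= mu]
    follows [mu - q = r(mu) <= r(lam) <= lam - q], so the radii agree and the bound for [G] is
    tight. *)
Lemma rho_le_path_iso (C : numClosedFieldType) (q b : nat) (G : sgraph) :
  0 < q -> 0 < b -> clique_tree q G -> #|G| = (b * q).+1 ->
  (rho C G <= rho C (path_block q b))%R ->
  rho C G = rho C (path_block q b) /\ iso G (path_block q b).
Proof.
move=> q_gt0 b_gt0 cG cardG le.
have [v0 [rt [v bound tight]]] := branch_seq_bound C q_gt0 b_gt0 cG cardG.
have eq_path := path_branch_seq C q_gt0 b_gt0.
have [/andP [_ anti] _] := branch_seq_anti q_gt0 (rho_ge0 C G) le v.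
rewrite eq_path in anti.
have eq_rho : rho C G = rho C (path_block q b).
  apply/le_anti; rewrite le /=.
  by rewrite -(lerD2r (- q%:R)%R); apply: le_trans anti bound.
split=> //; apply: (linear_iso_path (rt := rt)) => //.
by apply: tight; apply/le_anti; rewrite bound eq_rho eq_path lexx.
Qed.

(** * Combining both extremal bounds *)

Lemma block_class_card (n q : nat) (G : sgraph) : 0 < q ->
  block_class n q G -> 0 < (n - 1) %/ q /\ n = ((n - 1) %/ q * q).+1.
Proof.
move=> q_gt0 bG; have cG := block_class_clique_tree q_gt0 bG.
have n_gt1 := block_class_card_gt1 q_gt0 bG.
have [_ cardG _] := bG; have := clique_tree_card q_gt0 cG; rewrite cardG => e.
split=> //; rewrite lt0n; apply: contraTneq n_gt1 => b0.
by rewrite e b0.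
Qed.

Theorem theorem1p2 (C : numClosedFieldType) (q n : nat) (hq : (2 <= q)%N)
    (hne : exists G : sgraph, block_class n q G) :
  let b := ((n - 1) %/ q)%N in
  (block_class n q (star_block q b) /\
   forall G : sgraph, block_class n q G ->
     (rho C G <= rho C (star_block q b))%R /\
     (rho C G = rho C (star_block q b) -> iso G (star_block q b))) /\
  ((block_class n q (path_block q b) /\
    at_most_3_adjacent_cut_vertices (path_block q b)) /\
   forall G : sgraph, block_class n q G ->
     at_most_3_adjacent_cut_vertices G ->
     (rho C (path_block q b) <= rho C G)%R /\
     (rho C G = rho C (path_block q b) -> iso G (path_block q b))).
Proof.
have q_gt0 := ltnW hq; case: hne => G0 bG0 b.
have [b_gt0 en] := block_class_card q_gt0 bG0; rewrite -/b in b_gt0 en.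
have n_gt1 := block_class_card_gt1 q_gt0 bG0.
have cS := star_clique_tree q b.
have cP := path_clique_tree b q_gt0.
have eS : #|star_block q b| = n by rewrite card_star en.
have eP : #|path_block q b| = n by rewrite card_path en.
split; split.
- by rewrite -{1}eS; apply: clique_tree_block_class; rewrite ?eS.
- move=> G bG; have cG := block_class_clique_tree q_gt0 bG.
  have [_ cardG _] := bG.
  have [||le eq] := rho_le_no_far C cG cS _ _ (@star_no_far q b); rewrite ?eS //.
  split=> // /eq far0; have [c adj_c] := no_far_center cG far0.
  by apply: (center_iso_star q_gt0 b_gt0 cG _ adj_c); rewrite cardG.
- split; last exact: path_at_most_3.
  by rewrite -{1}eP; apply: clique_tree_block_class; rewrite ?eP.
- move=> G bG _; have cG := block_class_clique_tree q_gt0 bG.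
  have [_ cardG _] := bG; rewrite en in cardG.
  have main := rho_le_path_iso q_gt0 b_gt0 cG cardG.
  split=> [|e]; last first.
    by have [|_] := main C; first rewrite e.
  (* If [G] had a strictly smaller radius than the path-block, [rho_le_path_iso] would make the two
     radii equal. *)
  case: (real_leP (rho_real C (path_block q b)) (rho_real C G)) => // lt.
  by have [e _] := main C (ltW lt); rewrite e ltxx in lt.
Qed.
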